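(* The accessible set $\Gamma$ satisfies the following: (i) $\Gamma=\bigcap_{x\in M}\omega_\Psi(x)$; (ii) $\Gamma=\omega_\Psi(p)$ for all $p\in\Gamma$; (iii) $\Gamma$ is compact, connected, invariant and strongly positively invariant under $\Psi$; (iv) either $\Gamma$ has empty interior or its interior is dense in $\Gamma$.
   Context: Let $d\ge 1$ and let $E$ be a finite set. For each $i\in E$, $F^i:\mathbb R^d\to\mathbb R^d$ is a smooth bounded vector field with flow $\Phi^i=(\Phi^i_t)$, i.e. $t\mapsto \Phi^i_t(x)$ solves $\dot x=F^i(x)$ with value $x$ at time $0$. $M\subset\mathbb R^d$ is a compact set with $\Phi^i_t(M)\subset M$ for all $i\in E$, $t\ge 0$. For $n\ge 1$ let $\mathbb T_n=\{(\mathbf i,\mathbf u)=((i_0,\dots,i_n),(u_1,\dots,u_n))\in E^{n+1}\times\mathbb R_+^n\}$ and, for $(\mathbf i,\mathbf u)\in\mathbb T_n$, let $\mathbf\Phi^{\mathbf i}_{\mathbf u}=\Phi^{i_{n-1}}_{u_n}\circ\cdots\circ\Phi^{i_0}_{u_1}$. The positive orbit of $x$ is $\gamma^+(x)=\{\mathbf\Phi^{\mathbf i}_{\mathbf u}(x):(\mathbf i,\mathbf u)\in\bigcup_{n\ge 1}\mathbb T_n\}$, and the accessible set is the (possibly empty) compact set $\Gamma=\bigcap_{x\in M}\overline{\gamma^+(x)}\subset M$. Let $\mathrm{co}(F)(x)=\{\sum_{i\in E}\alpha_iF^i(x):\alpha_i\ge 0,\ \sum_i\alpha_i=1\}$. $S^x$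 is the set of absolutely continuous $\eta:\mathbb R_+\to\mathbb R^d$ with $\eta(0)=x$ and $\dot\eta(t)\in\mathrm{co}(F)(\eta(t))$ for almost all $t$; $S^x_{\mathbb R}$ is the analogous set of solutions $\eta:\mathbb R\to\mathbb R^d$ defined on all of $\mathbb R$ with $\eta(0)=x$. Put $\Psi_t(x)=\{\eta(t):\eta\in S^x\}$ for $t\ge0$, $\Psi_t(A)=\bigcup_{x\in A}\Psi_t(x)$ and $\Psi_{[t,\infty[}(x)=\bigcup_{s\ge t}\Psi_s(x)$. A set $A\subset\mathbb R^d$ is strongly positively invariant under $\Psi$ if $\Psi_t(A)\subset A$ for all $t\ge 0$; it is invariant if for all $x\in A$ there exists $\eta\in S^x_{\mathbb R}$ with $\eta(\mathbb R)\subset A$. The omega limit set of $x$ is $\omega_\Psi(x)=\bigcap_{t\ge 0}\overline{\Psi_{[t,\infty[}(x)}$. The empty set is regarded as connected. *)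

(* Defs.v *)
From mathcomp Require Import all_boot all_order all_algebra.
From mathcomp Require Import all_classical all_reals all_analysis.

Set Implicit Arguments.
Unset Strict Implicit.
Unset Printing Implicit Defensive.

Import Order.TTheory GRing.Theory Num.Theory.
Import numFieldNormedType.Exports.

Local Open Scope classical_set_scope.
Local Open Scope ring_scope.

Section Defs.
Variables (R : realType) (d : nat).
Implicit Types (f : 'rV[R]_d -> 'rV[R]_d) (x : 'rV[R]_d) (A : set 'rV[R]_d).

(* [f] is of class C^n: in finite dimension, C^(n+1) means differentiable with
   every directional derivative of class C^n. *)
Fixpoint class_C (n : nat) f : Prop :=
  match n with
  | 0 => continuous f
  | n.+1 => (forall x, differentiable f x) /\ (forall v, class_C n ('D_v f))
  end.

Definition smooth f := forall n, class_C n f.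

Definition is_flow f (phi : R -> 'rV[R]_d -> 'rV[R]_d) :=
  forall x, phi 0 x = x /\
    forall t : R, is_derive t (1 : R) (fun s => phi s x) (f (phi t x)).

Definition absolutely_continuous_on (a b : R) (eta : R -> 'rV[R]_d) :=
  forall e : R, 0 < e -> exists2 del : R, 0 < del &
    forall (n : nat) (l r : 'I_n -> R),
      (forall k, a <= l k /\ l k <= r k /\ r k <= b) ->
      trivIset setT (fun k => `]l k, r k[%classic) ->
      \sum_(k < n) (r k - l k) < del ->
      \sum_(k < n) `|eta (r k) - eta (l k)| < e.

Section Switched.
Variables (E : finType) (F : E -> 'rV[R]_d -> 'rV[R]_d).
Variable Phi : E -> R -> 'rV[R]_d -> 'rV[R]_d.

(* Phi^{i_{n-1}}_{u_n} o ... o Phi^{i_0}_{u_1}: [zip] drops the last index i_n,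
   which plays no role in the composition. *)
Definition composite_flow (i : seq E) (u : seq R) x : 'rV[R]_d :=
  foldl (fun y iu => Phi iu.1 iu.2 y) x (zip i u).

Definition positive_orbit x : set 'rV[R]_d :=
  [set y | exists (n : nat) (i : n.+1.-tuple E) (u : n.-tuple R),
     [/\ (1 <= n)%N, (forall k, 0 <= tnth u k) & y = composite_flow i u x]].

Definition accessible_set (M : set 'rV[R]_d) : set 'rV[R]_d :=
  \bigcap_(x in M) closure (positive_orbit x).

Definition coF x : set 'rV[R]_d :=
  [set v | exists alpha : E -> R,
     [/\ (forall i, 0 <= alpha i), \sum_i alpha i = 1
       & v = \sum_i alpha i *: F i x]].

(* Solutions on an interval [D] containing 0. Absolute continuity on [D] is on
   every compact subinterval. The values of [eta] outside [D] are irrelevant: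
   the two-sided derivative involves them only at the endpoints of [D], a
   Lebesgue-null set. *)
Definition solution_on (D : set R) x : set (R -> 'rV[R]_d) :=
  [set eta | [/\ eta 0 = x,
     (forall a b : R, `[a, b]%classic `<=` D ->
        absolutely_continuous_on a b eta)
   & {ae @lebesgue_measure R, forall t, D t ->
        exists2 v, coF (eta t) v & is_derive t (1 : R) eta v}]].

Definition sol_pos x := solution_on `[0, +oo[%classic x.

Definition sol_full x := solution_on [set: R] x.

Definition Psi (t : R) x : set 'rV[R]_d := [set eta t | eta in sol_pos x].

Definition Psi_set (t : R) A : set 'rV[R]_d := \bigcup_(x in A) Psi t x.

Definition Psi_from (t : R) x : set 'rV[R]_d :=
  \bigcup_(s in `[t, +oo[%classic) Psi s x.

Definition omega_limit x : set 'rV[R]_d :=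
  \bigcap_(t in `[0, +oo[%classic) closure (Psi_from t x).

Definition strongly_positively_invariant A :=
  forall t : R, 0 <= t -> Psi_set t A `<=` A.

Definition Psi_invariant A :=
  forall x, A x -> exists2 eta, sol_full x eta & range eta `<=` A.

End Switched.
End Defs.

(* Main.v *)
(* A curve eta solves the relaxed inclusion iff, for all s <= t, the increment
   eta t - eta s is (t - s) times a convex combination of the F i (eta s), up to
   an error C (t - s)^2. For a solution this is a mean value argument based on
   absolute continuity and the a.e. inclusion; conversely such a curve is
   Lipschitz, hence a.e. differentiable, with derivatives in the (compact) hull.
   An Euler scheme that realises each convex combination by fast switching shows
   that eta T lies in the closure of the positive orbit of eta 0 (relaxation),
   so that the closed sets generated by switched and by relaxed trajectories
   coincide. This gives (i), (ii) and positive invariance. The quadratic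
   characterisation is closed under pointwise limits, so a Tychonoff cluster
   point of switched trajectories in Gamma with longer and longer past, ending
   near p, is a complete solution through p. Connectedness holds since Gamma is
   the closure of an arcwise connected orbit, and (iv) since the flow maps are
   homeomorphisms preserving Gamma in positive time. *)

Require Import Defs.
From HB Require Import structures.
From mathcomp Require Import all_boot all_order all_algebra.
From mathcomp Require Import all_classical all_reals all_analysis.
From mathcomp Require Import ring lra.
Set Implicit Arguments.
Unset Strict Implicit.
Import Order.TTheory GRing.Theory Num.Theory.
Import numFieldNormedType.Exports.
Local Open Scope classical_set_scope.
Local Open Scope ring_scope.

(** * Lipschitz functions are differentiable almost everywhere *)

Definition locally_lipschitz (R : realType) (V W : normedModType R) (f : V -> W) :=
  forall r, exists2 L, 0 <= L & forall x y, `|x| <= r -> `|y| <= r ->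
    `|f x - f y| <= L * `|x - y|.

Lemma locally_lipschitz_continuous (R : realType) (V W : normedModType R) (f : V -> W) :
  locally_lipschitz f -> continuous f.
Proof.
move=> fL x; apply/(@cvgrPdist_lt _ W) => e e0.
have [K K0 KP] := fL (`|x| + 1).
have K1 : 0 < K + 1 by rewrite ltr_wpDl.
near=> y.
have xy : `|x - y| < e / (K + 1).
  by near: y; apply: cvgr_dist_lt => //; rewrite divr_gt0.
have y1 : `|x - y| < 1 by near: y; exact: cvgr_dist_lt.
apply: (@le_lt_trans _ _ (K * `|x - y|)).
  apply: KP; first by rewrite lerDl.
  rewrite -[y](subKr x) (le_trans (ler_normB _ _))// lerD2l.
  exact: ltW.
apply: (@le_lt_trans _ _ ((K + 1) * `|x - y|)); first by rewrite ler_wpM2r// lerDl.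
by rewrite mulrC -ltr_pdivlMr.
Unshelve. all: by end_near. Qed.

Lemma lipschitz_locally_lipschitz (R : realType) (V W : normedModType R) (f : V -> W)
    (L : R) :
  (forall x y, `|f x - f y| <= L * `|x - y|) -> locally_lipschitz f.
Proof.
move=> fL r; exists `|L| => // x y _ _; apply: le_trans (fL x y) _.
by rewrite ler_wpM2r// ler_norm.
Qed.

Lemma ae_sub (R : realType) (P Q : R -> Prop) : (forall t, P t -> Q t) ->
  {ae @lebesgue_measure R, forall t, P t} -> {ae @lebesgue_measure R, forall t, Q t}.
Proof. by move=> PQ; apply: negligibleS => t nQ Pt; exact/nQ/PQ. Qed.

(* Since [g + h = id], the Lebesgue-Stieltjes measure of [g] is dominated by
   Lebesgue measure; [g] is then locally an integral of its Radon-Nikodym density. *)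
Section cumulative_pair.
Variables (R : realType) (g h : cumulative R R).
Hypothesis gh : forall t, g t + h t = t.
Local Notation mu := (@lebesgue_measure R).
Local Notation mg := (lebesgue_stieltjes_measure g).
Local Notation mh := (lebesgue_stieltjes_measure h).

Lemma lebesgue_stieltjes_ocitv (k : cumulative R R) (a b : R) : a <= b ->
  lebesgue_stieltjes_measure k `]a, b]%classic = (k b - k a)%:E.
Proof.
move=> ab; rewrite /lebesgue_stieltjes_measure /measure_extension/=.
rewrite measurable_mu_extE/=; last exact: is_ocitv.
by rewrite wlength_itv_bnd// EFinB.
Qed.

(** The sum of the two measures gives []a, b]] the mass [b - a], since [g + h] is the identity, and
    this characterises Lebesgue measure. *)
Lemma lebesgue_stieltjes_add (A : set (measurableTypeR R)) : measurable A ->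
  mu A = (mg A + mh A)%E.
Proof.
move=> mA.
pose m : {measure set (measurableTypeR R) -> \bar R} := measure_add mg mh.
have mE X : m X = (mg X + mh X)%E by rewrite /m /= /msum 2!big_ord_recl/= big_ord0 adde0.
rewrite -[RHS](mE A).
apply: (@lebesgue_measure_unique R m) => //.
move=> X [[a b] _ <-]; rewrite mE /=.
have [ba|ab] := ltP b a.
  by rewrite set_itv_ge ?measure0 ?adde0// bnd_simp -leNgt ltW.
rewrite !lebesgue_stieltjes_ocitv// -EFinD /lebesgue_measure.
rewrite lebesgue_stieltjes_ocitv//=; congr EFin.
by rewrite -[X in X - _ = _]gh -[X in _ - X = _]gh; ring.
Qed.

(** The indefinite integral of a Radon-Nikodym density is differentiable almost everywhere;
    restricting to []-n, n]] makes the density integrable on the line. *)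
Lemma lebesgue_stieltjes_derivable_bnd (n : R) : 0 < n ->
  {ae mu, forall t, - n < t < n -> derivable g t 1}.
Proof.
move=> n0; pose D : set (measurableTypeR R) := `]- n, n]%classic.
have mD : measurable D by exact: measurable_itv.
have mgD : (mg D < +oo)%E by rewrite lebesgue_stieltjes_ocitv ?ltry// ge0_cp// ltW.
pose nu : {finite_measure set _ -> \bar R} := mfrestr mD mgD.
have numu : nu `<< mu.
  apply/null_content_dominatesP => A mA muA0.
  have : mu (A `&` D) = 0%E.
    by apply/eqP; rewrite eq_le measure_ge0 andbT -muA0 le_measure ?inE//; exact: measurableI.
  rewrite lebesgue_stieltjes_add; last exact: measurableI.
  by move/eqP; rewrite padde_eq0 ?measure_ge0// => /andP[/eqP].
have [f [f0 ffin fint fE]] := radon_nikodym_sigma_finite numu.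
pose fr t := fine (f t).
have fK t : (fr t)%:E = f t by rewrite fineK.
have fK' : EFin \o fr = f by apply/funext.
have iA y : mu.-integrable `]-oo, y] (EFin \o fr).
  by rewrite fK'; apply: integrableS fint.
have lf : locally_integrable [set: R] fr.
  have := @integrable_locally R fr setT measurableT.
  by rewrite patch_setT; apply; rewrite fK'.
have := FTC1Ny iA lf; apply: ae_sub => t /= [dF _] /andP[nt tn].
(* Near [t] this equals [g]: the integral is [nu] of []-oo, x]], that is [g x - g (- n)]. *)
pose G (x : R) := g (- n) + (\int[mu]_(t in `]-oo, x]) fr t).
have dG : derivable G t 1 by exact (derivableD (derivable_cst _ _ _) dF).
apply: near_eq_derivable dG; near=> x; rewrite /G.
have xn : - n <= x by near: x; exact: (cvgr_ge t cvg_id).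
have xn' : x <= n by near: x; exact: (cvgr_le t cvg_id).
rewrite /Rintegral; under eq_integral do rewrite fK.
rewrite -fE//; rewrite /nu/= /mfrestr /mrestr.
have -> : (`]-oo, x] `&` D = `]- n, x])%classic.
  rewrite /D; apply/seteqP; split => z; rewrite /= !in_itv/=.
    by move=> [zx /andP[nz _]]; rewrite nz zx.
  by move=> /andP[nz zx]; rewrite nz zx (le_trans zx xn').
by rewrite lebesgue_stieltjes_ocitv//=; ring.
Unshelve. all: by end_near. Qed.

Lemma lebesgue_stieltjes_derivable_ae : {ae mu, forall t, derivable g t 1}.
Proof.
have H (n : nat) := @lebesgue_stieltjes_derivable_bnd n.+1%:R (ltr0Sn _ n).
have := negligible_bigcup H; apply: negligibleS => t /= nd.
exists (Num.Def.truncn `|t|) => //= K; apply: nd; apply: K.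
by rewrite -ltr_norml; exact: Num.Theory.truncnS_gt.
Qed.

End cumulative_pair.

(** For a positive Lipschitz constant [K], both [(id + f/K)/2] and [(id - f/K)/2] are nondecreasing
    and they add up to the identity; [f] is a linear combination of the first one and the
    identity. *)
Lemma lipschitz_derivable_ae (R : realType) (f : R -> R) (L : R) :
  (forall x y, `|f x - f y| <= L * `|x - y|) ->
  {ae @lebesgue_measure R, forall t, derivable f t 1}.
Proof.
move=> fL.
have L0 : 0 < `|L| + 1 by rewrite ltr_pwDr.
have fL' x y : `|f x - f y| <= (`|L| + 1) * `|x - y|.
  apply: (le_trans (fL x y)); apply: ler_wpM2r => //.
  by apply: (le_trans (ler_norm _)); rewrite lerDl.
have cf := locally_lipschitz_continuous (lipschitz_locally_lipschitz fL).
set K := `|L| + 1 in L0 fL'.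
have half (s : R) : `|s| = 1 ->
  nondecreasing (fun t => 2^-1 * (t + s * K^-1 * f t)) /\
  right_continuous (fun t => 2^-1 * (t + s * K^-1 * f t)).
  move=> s1; split.
    move=> x y xy; rewrite ler_pM2l ?invr_gt0// -subr_ge0.
    have -> : y + s * K^-1 * f y - (x + s * K^-1 * f x) =
      y - x - s * (K^-1 * (f x - f y)) by ring.
    rewrite subr_ge0; apply: (le_trans (ler_norm _)).
    rewrite normrM s1 mul1r normrM gtr0_norm ?invr_gt0//.
    rewrite ler_pdivrMl//; apply: le_trans (fL' _ _) _.
    by rewrite distrC ger0_norm// subr_ge0.
  apply: right_continuousW => x.
  apply: cvgM; first exact: cvg_cst.
  apply: cvgD; first exact: cvg_id.
  by apply: cvgM; [exact: cvg_cst|exact: cf].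
have [g1 g2] := half 1 (normr1 _).
have [h1 h2] := half (-1) (normrN1 _).
pose g : cumulative R R := HB.pack (fun t => 2^-1 * (t + 1 * K^-1 * f t))
  (isCumulative.Build R _ R _ g1 g2).
pose h : cumulative R R := HB.pack (fun t => 2^-1 * (t + -1 * K^-1 * f t))
  (isCumulative.Build R _ R _ h1 h2).
have gh t : g t + h t = t by rewrite /g /h/=; field; rewrite gt_eqF.
have := lebesgue_stieltjes_derivable_ae gh; apply: ae_sub => t /= dg.
have -> : f = (fun t => K * (2 * g t - t)).
  by apply/funext => u; rewrite /g/=; field; rewrite gt_eqF.
have d2 := derivableM (derivable_cst (2 : R) t 1) dg.
have di : derivable (id : R -> R) t 1 by exact: derivable_id.
exact (derivableM (derivable_cst K t 1) (derivableB d2 di)).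
Qed.

(** * Mean values of absolutely continuous curves *)

(** Cousin's lemma as an induction principle, replacing fine tagged partitions. Local validity at
    the supremum of the [y] with [P a y] carries [P a] past it, unless it is [b]. *)
Lemma cousin_ind (R : realType) (P : R -> R -> Prop) (a b : R) : a <= b ->
  (forall x y z, a <= x -> x <= y -> y <= z -> z <= b -> P x y -> P y z -> P x z) ->
  (forall u, a <= u -> u <= b -> exists2 del, 0 < del & forall x y,
     a <= x -> x <= u -> u <= y -> y <= b -> u - x < del -> y - u < del -> P x y) ->
  P a b.
Proof.
move=> ab Padd Ploc.
pose S := [set y | [/\ a <= y, y <= b & P a y]].
have Sa : S a.
  split => //; have [del d0] := Ploc a (lexx _) ab.
  by apply => //; rewrite subrr.
have ubS : ubound S b by move=> y [].
have hS : has_sup S by split; [exists a|exists b].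
have as_ : a <= sup S by apply: ub_le_sup => //; exists b.
have sb : sup S <= b by apply: ge_sup => //; exists a.
have [del d0 Ps] := Ploc _ as_ sb.
have [y [ay yb Pay] ys] := sup_adherent d0 hS.
have yS : y <= sup S by apply: ub_le_sup => //; exists b.
have Pz z : sup S <= z -> z <= b -> z - sup S < del -> P a z.
  move=> sz zb zd; apply: (Padd a y z) => //; first exact: le_trans yS sz.
  by apply: Ps => //; rewrite ltrBlDr addrC -ltrBlDr.
have [sb'|] := ltP (sup S) b; last first.
  by move=> bs; apply: Pz => //; rewrite (@le_lt_trans _ _ 0)// subr_le0.
pose z := Num.min b (sup S + del / 2).
have sz : sup S < z by rewrite lt_min sb' ltrDl divr_gt0.
have zb : z <= b by rewrite ge_min lexx.
have /(ub_le_sup (ex_intro _ b ubS)) : S z.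
  split => //; first by rewrite (le_trans as_)// ltW.
  apply: Pz => //; first exact: ltW.
  rewrite ltrBlDr addrC (@le_lt_trans _ _ (sup S + del / 2))//.
    by rewrite ge_min lexx orbT.
  by rewrite ltrD2l ltr_pdivrMr// ltr_pMr// ltr1n.
by rewrite leNgt sz.
Qed.

(** Absolute continuity is tested on the total length of finitely many intervals, whereas smallness
    of an exceptional set is known as a measure bound on an open cover. *)
Lemma lebesgue_disjoint_itv_le (R : realType) (U : set R) n (l r : 'I_n -> R) :
  open U -> (forall k, l k <= r k) -> trivIset setT (fun k => `]l k, r k[%classic) ->
  (forall k, `]l k, r k[%classic `<=` U) ->
  ((\sum_(k < n) (r k - l k))%:E <= @lebesgue_measure R U)%E.
Proof.
move=> oU lr tI sU; rewrite -sumEFin.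
pose G (k : 'I_n) : set (measurableTypeR R) := `]l k, r k[%classic.
have mG k : measurable (G k) by exact: measurable_itv.
have -> : (\sum_(k < n) (r k - l k)%:E = \sum_(k < n) @lebesgue_measure R (G k))%E.
  apply: eq_bigr => k _; rewrite /G lebesgue_measure_itv/= lte_fin.
  case: ltP => // rl; have -> : r k = l k by apply/eqP; rewrite eq_le rl lr.
  by rewrite subrr.
rewrite -measure_semi_additive_ord//; last exact: bigsetU_measurable.
apply: le_measure; rewrite ?inE//.
- exact: bigsetU_measurable.
- exact: measurable_realfun.open_measurable.
- apply: (big_ind (fun X => X `<=` U)) => [//|X Y XU YU|k _]; last exact: sU.
  by rewrite subUset.
Qed.

(** The first-order expansion without division, valid at [w = u] too; used on both sides of a tag it
    gives the straddle estimate for an interval around it. *)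
Lemma is_derive_le (R : realType) (V : normedModType R) (f : R -> V) (u : R) (v : V) :
  is_derive u (1 : R) f v -> forall e, 0 < e -> exists2 del, 0 < del &
    forall w, `|w - u| < del -> `|f w - f u - (w - u) *: v| <= e * `|w - u|.
Proof.
move=> [/= df dv] e e0.
have := df; rewrite /derivable => /cvgrPdist_le /(_ _ e0).
rewrite near_withinE /= => -[del d0 H]; exists del => // w wu.
have [->|wu0] := eqVneq w u; first by rewrite !subrr scale0r subr0 !normr0 mulr0.
have := H (w - u); rewrite /ball_/= sub0r normrN => /(_ wu).
rewrite subr_eq0 => /(_ wu0).
have -> : lim ((fun h : R => h^-1 *: (f (h%:A + u) - f u)) h @[h --> 0^']) = v.
  exact: dv.
rewrite [(w - u)%:A]mulr1 subrK.
have wu1 : w - u != 0 by rewrite subr_eq0.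
move=> L.
have -> : f w - f u - (w - u) *: v = - ((w - u) *: (v - (w - u)^-1 *: (f w - f u))).
  by rewrite scalerBr scalerA divff// scale1r opprB.
by rewrite normrN normrZ mulrC ler_wpM2r.
Qed.

Lemma scaler_avg (R : realType) (V : lmodType R) (s t : R) (x y : V) : s + t != 0 ->
  (s + t) *: ((s / (s + t)) *: x + (1 - s / (s + t)) *: y) = s *: x + t *: y.
Proof.
move=> st0; rewrite scalerDr !scalerA; congr (_ *: _ + _ *: _); by field.
Qed.

Section ac_average.
Variables (R : realType) (d : nat) (K : set 'rV[R]_d) (eta : R -> 'rV[R]_d).
Variables (a b : R) (k0 : 'rV[R]_d).
Hypotheses (ab : a <= b) (ac : absolutely_continuous_on a b eta).
Hypothesis Kconv : forall x y (t : R), 0 <= t -> t <= 1 -> K x -> K y ->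
  K (t *: x + (1 - t) *: y).
Hypothesis Kk0 : K k0.
Hypothesis Kder : {ae @lebesgue_measure R, forall t, a <= t <= b ->
  exists2 v, K v & is_derive t (1 : R) eta v}.

Let Kconv2 x y (s t : R) : 0 <= s -> 0 <= t -> K x -> K y ->
  exists2 z, K z & (s + t) *: z = s *: x + t *: y.
Proof.
move=> s0 t0 Kx Ky; have [st|st] := eqVneq (s + t) 0.
  have s00 : s = 0 by lra.
  have t00 : t = 0 by lra.
  by exists x => //; rewrite s00 t00 addr0 !scale0r addr0.
exists ((s / (s + t)) *: x + (1 - s / (s + t)) *: y); last exact: scaler_avg.
have st0 : 0 < s + t by rewrite lt_def st addr_ge0.
apply: Kconv => //; first by rewrite divr_ge0// ltW.
by rewrite ler_pdivrMr// mul1r lerDl.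
Qed.

Let defect (p : R * R) := `|eta p.2 - eta p.1 - (p.2 - p.1) *: k0|.

(* Bad tags are covered by the small open set [U]; their intervals are recorded
   in [s] and the average over them is taken to be [k0]. *)
Let partial (U : set R) (e x y : R) := exists (s : seq (R * R)) (k : 'rV[R]_d),
  [/\ K k, (forall p, p \in s -> [/\ x <= p.1, p.1 <= p.2, p.2 <= y &
      `]p.1, p.2[%classic `<=` U]),
    pairwise (fun p q : R * R => p.2 <= q.1) s
  & `|eta y - eta x - (y - x) *: k| <= e * (y - x) + \sum_(p <- s) defect p].

Let partial_add U e x y z : x <= y -> y <= z ->
  partial U e x y -> partial U e y z -> partial U e x z.
Proof.
move=> xy yz [s1 [k1 [Kk1 s1P s1p H1]]] [s2 [k2 [Kk2 s2P s2p H2]]].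
have xy0 : 0 <= y - x by rewrite subr_ge0.
have yz0 : 0 <= z - y by rewrite subr_ge0.
have [k Kk kE] := Kconv2 xy0 yz0 Kk1 Kk2.
exists (s1 ++ s2), k; split => //.
- move=> p; rewrite mem_cat => /orP[/s1P[? ? ? ?]|/s2P[? ? ? ?]]; split => //.
    exact: le_trans yz.
  exact: le_trans xy _.
- rewrite pairwise_cat s1p s2p !andbT; apply/allrelP => p q /s1P[_ _ py _] /s2P[yq _ _ _].
  exact: le_trans yq.
- rewrite big_cat/=.
  have -> : z - x = (y - x) + (z - y) by ring.
  rewrite kE.
  have -> : eta z - eta x - ((y - x) *: k1 + (z - y) *: k2) =
    (eta y - eta x - (y - x) *: k1) + (eta z - eta y - (z - y) *: k2).
    by apply/rowP => j; rewrite !mxE; ring.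
  apply: le_trans (ler_normD _ _) _.
  by rewrite mulrDr addrACA lerD.
Qed.

(** Cousin induction. Outside an open set [U] covering the exceptional null set, the derivative at
    the tag serves as average; tags in [U] get [k0], and absolute continuity makes their total
    contribution small. *)
Lemma ac_average e : 0 < e ->
  exists2 k, K k & `|eta b - eta a - (b - a) *: k| <= e.
Proof.
move=> e0.
pose e3 := e / 3.
have e30 : 0 < e3 by rewrite divr_gt0.
have ba1 : 0 < b - a + 1 by rewrite ltr_wpDl// subr_ge0.
have [del d0 acd] := ac e30.
have k1 : 0 < `|k0| + 1 by rewrite ltr_wpDl.
(* The first bound serves absolute continuity on the bad intervals; the second keeps [|k0|] times
   their total length at most [e3]. *)
pose m := Num.min del (e3 / (`|k0| + 1)).
have m0 : 0 < m by rewrite lt_min d0 divr_gt0.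
have [A [mA A0 sA]] := Kder.
have [U [oU AU UA]] : exists U : set R, [/\ open U, A `<=` U &
    (@lebesgue_measure R (U `\` A) < m%:E)%E].
  by apply: lebesgue_regularity_outer => //; rewrite [X in (X < _)%E]A0 ltry.
have muU : (@lebesgue_measure R U < m%:E)%E.
  apply: le_lt_trans UA.
  have mU : measurable (U : set (measurableTypeR R)).
    exact: measurable_realfun.open_measurable.
  apply: (@le_trans _ _ (lebesgue_measure (U `\` A) + lebesgue_measure A)%E).
    have mUA : measurable (U `\` A : set (measurableTypeR R)) by exact: measurableD.
    by have := measureU2 (@lebesgue_measure R) mUA mA; rewrite setUC (setDUK AU).
  by rewrite [X in (_ + X)%E]A0 adde0.
pose e' := e3 / (b - a + 1).
have e'0 : 0 < e' by rewrite divr_gt0.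
have [s [k [Kk sP sp H]]] : partial U e' a b.
  apply: cousin_ind => //.
    by move=> x y z _ xy yz _; exact: partial_add.
  move=> u au ub.
  (* A derivative need not exist at a tag in [U]: the interval is kept inside [U] and recorded, and
     its defect is charged to the sum. *)
  have [Uu|nUu] := pselect (U u).
    have /nbhs_ballP[del' /= d'0 bU] : nbhs u U by exact: open_nbhs_nbhs.
    exists del' => // x y ax xu uy yb ux yu.
    exists [:: (x, y)], k0; split => //=.
      move=> p; rewrite inE => /eqP ->/=; split => //; first exact: le_trans xu uy.
      move=> w; rewrite /= in_itv/= => /andP[xw wy]; apply: bU.
      rewrite /ball/= ltr_distlC; apply/andP; split; lra.
    by rewrite big_seq1/= /defect/= lerDr mulr_ge0 ?(ltW e'0)// subr_ge0 (le_trans xu uy).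
  have [v Kv dv] : exists2 v, K v & is_derive u (1 : R) eta v.
    apply: contrapT => nv; apply/nUu/AU/sA => /= H; apply: nv; apply: H.
    by rewrite au ub.
  have [del' d'0 dd] := is_derive_le dv e'0.
  exists del' => // x y ax xu uy yb ux yu.
  exists [::], v; split => //; rewrite big_nil addr0.
  have -> : eta y - eta x - (y - x) *: v =
     (eta y - eta u - (y - u) *: v) - (eta x - eta u - (x - u) *: v).
    by apply/rowP => j; rewrite !mxE; ring.
  apply: le_trans (ler_normB _ _) _.
  have -> : y - x = (y - u) + (u - x) by ring.
  rewrite mulrDr lerD//.
    have := dd y; rewrite ger0_norm ?subr_ge0// => /(_ yu); done.
  by have := dd x; rewrite distrC ger0_norm ?subr_ge0// => /(_ ux).
exists k => //; apply: le_trans H _.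
have e1 : e' * (b - a) <= e3.
  rewrite /e' mulrAC ler_pdivrMr//; apply: ler_wpM2l; first exact: ltW.
  by rewrite lerDl.
pose n := size s; pose x0 : R * R := (0, 0).
pose l (i : 'I_n) := (nth x0 s i).1; pose r (i : 'I_n) := (nth x0 s i).2.
have lP i : [/\ a <= l i, l i <= r i, r i <= b & `]l i, r i[%classic `<=` U].
  by apply: sP; exact: mem_nth.
have tI : trivIset setT (fun i => `]l i, r i[%classic).
  have lt_disj (i j : 'I_n) : (i < j)%N -> r i <= l j.
    move=> ij; move/(pairwiseP x0): sp; apply => //; exact: ltn_ord.
  apply/trivIsetP => i j _ _ ij; apply/seteqP; split => // w [] /=; rewrite !in_itv/=.
  move=> /andP[li ri] /andP[lj rj].
  have [ltij|ltji|/val_inj eqij] := ltngtP i j; last by rewrite eqij eqxx in ij.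
    by have := lt_disj _ _ ltij; lra.
  by have := lt_disj _ _ ltji; lra.
have summ : \sum_(i < n) (r i - l i) < m.
  rewrite -lte_fin; apply: le_lt_trans muU.
  by apply: lebesgue_disjoint_itv_le => // i; have [] := lP i.
have lr0 (i : 'I_n) : 0 <= r i - l i by rewrite subr_ge0; have [] := lP i.
have S1 : \sum_(i < n) `|eta (r i) - eta (l i)| < e3.
  apply: acd => //; first by move=> i; have [] := lP i.
  by apply: lt_le_trans summ _; rewrite ge_min lexx.
have S2 : `|k0| * \sum_(i < n) (r i - l i) <= e3.
  apply: (@le_trans _ _ ((`|k0| + 1) * m)).
    apply: ler_pM => //; rewrite ?sumr_ge0//; last exact: ltW.
    by rewrite lerDl.
  by rewrite mulrC -ler_pdivlMr// ge_min lexx orbT.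
have S3 : \sum_(p <- s) defect p <= \sum_(i < n) `|eta (r i) - eta (l i)| +
    `|k0| * \sum_(i < n) (r i - l i).
  rewrite (big_nth x0) big_mkord mulr_sumr -big_split/=; apply: ler_sum => i _.
  rewrite /defect; apply: le_trans (ler_normB _ _) _.
  by rewrite normrZ ger0_norm ?lr0// mulrC.
apply: le_trans (lerD e1 S3) _.
have -> : e = e3 + (e3 + e3) by rewrite /e3; field.
by rewrite lerD2l lerD// ltW.
Qed.

End ac_average.

(** * Flows of locally Lipschitz fields *)

(** Mean value inequality with a reference velocity [w], by Cousin induction with slope [c + e'],
    where the arbitrarily small [e'] absorbs the differentiation error at the tag. *)
Lemma is_derive_increment_le (R : realType) (d : nat) (eta deta : R -> 'rV[R]_d)
    (a b c : R) (w : 'rV[R]_d) : a <= b ->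
  (forall t, a <= t <= b -> is_derive t (1 : R) eta (deta t)) ->
  (forall t, a <= t <= b -> `|deta t - w| <= c) ->
  `|eta b - eta a - (b - a) *: w| <= c * (b - a).
Proof.
move=> ab deta_ le_c; apply/ler_addgt0Pr => e e0.
pose e' := e / (b - a + 1).
have ba1 : 0 < b - a + 1 by rewrite ltr_wpDl// subr_ge0.
have e'0 : 0 < e' by rewrite divr_gt0.
suff H : `|eta b - eta a - (b - a) *: w| <= (c + e') * (b - a).
  apply: (le_trans H); rewrite mulrDl lerD2l /e' mulrAC ler_pdivrMr// ler_pM2l//.
  by rewrite lerDl.
apply: (@cousin_ind R (fun x y => `|eta y - eta x - (y - x) *: w| <= (c + e') * (y - x))) => //.
  move=> x y z _ xy yz _ H1 H2.
  have -> : eta z - eta x - (z - x) *: w =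
    (eta y - eta x - (y - x) *: w) + (eta z - eta y - (z - y) *: w).
    by apply/rowP => j; rewrite !mxE; ring.
  apply: le_trans (ler_normD _ _) _.
  have -> : z - x = (y - x) + (z - y) by ring.
  by rewrite mulrDr lerD.
move=> u au ub.
have uab : a <= u <= b by rewrite au ub.
have [del d0 dd] := is_derive_le (deta_ u uab) e'0.
exists del => // x y ax xu uy yb ux yu.
have -> : eta y - eta x - (y - x) *: w =
    ((eta y - eta u - (y - u) *: deta u) - (eta x - eta u - (x - u) *: deta u))
    + (y - x) *: (deta u - w).
  by apply/rowP => j; rewrite !mxE; ring.
apply: le_trans (ler_normD _ _) _; rewrite addrC mulrDl; apply: lerD.
  by rewrite normrZ ger0_norm ?subr_ge0 ?(le_trans xu uy)// mulrC ler_wpM2r ?subr_ge0 ?(le_trans xu uy) ?le_c.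
apply: le_trans (ler_normB _ _) _.
have -> : y - x = (y - u) + (u - x) by ring.
rewrite mulrDr lerD//.
  by have := dd y; rewrite ger0_norm ?subr_ge0// => /(_ yu).
by have := dd x; rewrite distrC ger0_norm ?subr_ge0// => /(_ ux).
Qed.

Lemma is_derive_of_le (R : realType) (V : normedModType R) (f : R -> V) (u : R) (v : V) :
  (forall e, 0 < e -> exists2 del, 0 < del &
    forall w, `|w - u| < del -> `|f w - f u - (w - u) *: v| <= e * `|w - u|) ->
  is_derive u (1 : R) f v.
Proof.
move=> H.
have L : (fun h : R => h^-1 *: ((f \o shift u) (h *: (1 : R)) - f u)) @ 0^' --> v.
  apply/cvgrPdist_le => e e0; have [del d0 dd] := H e e0.
  rewrite near_withinE /=; exists del => // h; rewrite /ball_/= sub0r normrN => hd h0.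
  have := dd (u + h); rewrite addrAC subrr add0r => /(_ hd) K.
  rewrite [h%:A]mulr1.
  have -> : v - h^-1 *: (f (h + u) - f u) = - (h^-1 *: (f (u + h) - f u - h *: v)).
    by rewrite [in RHS]scalerBr scalerA mulVf// scale1r opprB [h + u]addrC.
  by rewrite normrN normrZ normfV ler_pdivrMl ?normr_gt0// mulrC.
by split; [apply/cvg_ex; exists v|apply/cvg_lim].
Qed.

Lemma is_derive_reflect (R : realType) (V : normedModType R) (f : R -> V) (u : R) (v : V) :
  is_derive (- u) (1 : R) f v -> is_derive u (1 : R) (fun t => f (- t)) (- v).
Proof.
move=> df; apply: is_derive_of_le => e e0; have [del d0 dd] := is_derive_le df e0.
exists del => // w wu; have := dd (- w).
have -> : - w - - u = - (w - u) by ring.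
by rewrite normrN scaleNr scalerN => /(_ wu).
Qed.

Lemma is_derive_translate (R : realType) (V : normedModType R) (f : R -> V) (s u : R) (v : V) :
  is_derive (u + s) (1 : R) f v -> is_derive u (1 : R) (fun t => f (t + s)) v.
Proof.
move=> df; apply: is_derive_of_le => e e0; have [del d0 dd] := is_derive_le df e0.
exists del => // w wu; have := dd (w + s).
have -> : w + s - (u + s) = w - u by ring.
exact.
Qed.

Lemma locally_lipschitzN (R : realType) (d : nat) (f : 'rV[R]_d -> 'rV[R]_d) :
  locally_lipschitz f -> locally_lipschitz (fun x => - f x).
Proof.
move=> fL r; have [L L0 H] := fL r; exists L => // x y xr yr.
by rewrite -opprD normrN; exact: H.
Qed.

Lemma closed_ball_rV_compact (R : realType) (d : nat) (r : R) :
  compact [set x : 'rV[R]_d | `|x| <= r].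
Proof.
apply: bounded_closed_compact.
  exists r; split; first exact: num_real.
  by move=> M rM x /= xr; apply: le_trans xr (ltW rM).
by apply: closed_comp (@closed_le R r) => x _; exact: norm_continuous.
Qed.

Lemma coord_normr_le (R : realType) (d : nat) (x : 'rV[R]_d) j : `|x 0 j| <= `|x|.
Proof. by rewrite [leRHS]/Num.Def.normr/= mx_normrE; exact: (le_bigmax _ _ (0, j)). Qed.

(** Along the segment from [y] to [x] the derivative expands in coordinate directions, whose
    derivatives are continuous, hence bounded on the compact ball. *)
Lemma class_C1_locally_lipschitz (R : realType) (d : nat) (f : 'rV[R]_d -> 'rV[R]_d) :
  class_C 1 f -> locally_lipschitz f.
Proof.
move=> /= [df cf] r.
have [r0|r0] := ltP r 0.
  exists 0 => // x y xr _; have := le_lt_trans xr r0.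
  by rewrite ltNge normr_ge0.
have bnd (v : 'rV[R]_d) : exists2 L, 0 <= L & forall z, `|z| <= r -> `|'D_v f z| <= L.
  have [|||c _ cP] := @compact_EVT_max _ R (fun z => `|'D_v f z|) [set z : 'rV[R]_d | `|z| <= r].
  - by exists 0; rewrite /= normr0.
  - exact: closed_ball_rV_compact.
  - apply: continuous_subspaceT => z; apply: continuous_comp; first exact: cf.
    exact: norm_continuous.
  - exists `|'D_v f c|; first exact: normr_ge0.
    by move=> z zr; apply: cP; rewrite inE.
pose B j := sval (cid2 (bnd (delta_mx 0 j))).
have [B0 BP] : (forall j, 0 <= B j) /\
    (forall j z, `|z| <= r -> `|'D_(delta_mx 0 j) f z| <= B j).
  by split=> j; rewrite /B; case: cid2.
exists (\sum_j B j); first exact: sumr_ge0.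
move=> x y xr yr.
pose z t := y + t *: (x - y).
have zr t : 0 <= t <= 1 -> `|z t| <= r.
  move=> /andP[t0 t1].
  have -> : z t = t *: x + (1 - t) *: y by apply/rowP => j; rewrite !mxE; ring.
  apply: le_trans (ler_normD _ _) _; rewrite !normrZ !ger0_norm ?subr_ge0//.
  have -> : r = t * r + (1 - t) * r by ring.
  by rewrite lerD// ler_wpM2l// subr_ge0.
have dz t : is_derive t (1 : R) (f \o z) ('D_(x - y) f (z t)).
  have /derivableP [dfz _] : derivable f (z t) (x - y) by exact/diff_derivable/df.
  have E : (fun h : R => h^-1 *: (((f \o z) \o shift t) (h *: (1 : R)) - (f \o z) t)) =
     (fun h : R => h^-1 *: ((f \o shift (z t)) (h *: (x - y)) - f (z t))).
    apply/funext => h /=; congr (_ *: (f _ - _)); rewrite [h%:A]mulr1.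
    by rewrite /z; apply/rowP => j; rewrite !mxE; ring.
  by split; rewrite /derivable /derive E.
have := @is_derive_increment_le R d (f \o z) (fun t => 'D_(x - y) f (z t)) 0 1
   ((\sum_j B j) * `|x - y|) 0 ler01 (fun t _ => dz t).
rewrite /= subr0 mulr1 scaler0 subr0 /z scale1r scale0r addr0 [y + _]addrC subrK; apply.
move=> t t01; rewrite subr0 deriveE; last exact: df.
rewrite [x - y as X in 'd _ _ X]row_sum_delta linear_sum/=.
apply: le_trans (ler_norm_sum _ _ _) _; rewrite mulr_suml; apply: ler_sum => j _.
rewrite linearZ/= normrZ mulrC ler_pM//; last exact: coord_normr_le.
by rewrite -deriveE; [exact/BP/zr|exact: df].
Qed.

(** Each step multiplies by at most [expR (L * h)], and each local error [C * h ^+ 2] is enlarged by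
    at most the full exponential. *)
Lemma gronwall_discrete (R : realType) (e : nat -> R) (L h C : R) (N : nat) :
  0 <= L -> 0 <= h -> 0 <= C -> 0 <= e 0%N ->
  (forall k, (k < N)%N -> e k.+1 <= (1 + L * h) * e k + C * h ^+ 2) ->
  e N <= expR (L * (h * N%:R)) * (e 0%N + C * h ^+ 2 * N%:R).
Proof.
move=> L0 h0 C0 e0 H.
have c0 : 0 <= C * h ^+ 2 by rewrite mulr_ge0// sqr_ge0.
have a1 : 1 + L * h <= expR (L * h) by exact: expR_ge1Dx.
have Lh : 0 <= L * h by rewrite mulr_ge0.
have a1' : 1 <= expR (L * h) by apply: le_trans a1; rewrite lerDl.
have -> : expR (L * (h * N%:R)) = expR (L * h) ^+ N.
  by rewrite -expRM_natl; congr expR; ring.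
elim: N H => [|n IH] H; first by rewrite expr0 mul1r mulr0 addr0.
have {}IH := IH (fun k kn => H k (ltnW kn)).
apply: (le_trans (H n (ltnSn _))).
have -> : e 0%N + C * h ^+ 2 * n.+1%:R = (e 0%N + C * h ^+ 2 * n%:R) + C * h ^+ 2.
  by rewrite -[n.+1]addn1 natrD; ring.
rewrite mulrDr lerD//; last first.
  by rewrite -[leLHS]mul1r ler_wpM2r// exprn_ege1.
have p0 : 0 <= 1 + L * h by rewrite addr_ge0.
apply: (le_trans (ler_wpM2l p0 IH)); rewrite [expR _ ^+ n.+1]exprS -[leRHS]mulrA ler_wpM2r//.
by rewrite mulr_ge0 ?exprn_ge0 ?expR_ge0// addr_ge0// mulr_ge0.
Qed.

Lemma le_div_nat_le (R : realType) (x y c : R) :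
  (forall n : nat, x <= y + c / n.+1%:R) -> x <= y.
Proof.
move=> H; apply/ler_addgt0Pr => e e0.
have c1 : 0 < `|c| + 1 by rewrite ltr_wpDl.
pose n := Num.Def.truncn ((`|c| + 1) / e).
apply: (le_trans (H n)); rewrite lerD2l ler_pdivrMr// mulrC.
apply: (@le_trans _ _ (`|c| + 1)); first by rewrite (le_trans (ler_norm _))// lerDl.
rewrite -ler_pdivrMr//; apply: ltW; exact: Num.Theory.truncnS_gt.
Qed.

(** With [n + 1] equal steps the local errors sum to a multiple of [C * T ^+ 2 / (n + 1)], which
    vanishes as [n] grows. *)
Lemma gronwall_step (R : realType) (e : R -> R) (L C T : R) :
  0 <= L -> 0 <= C -> 0 <= T -> 0 <= e 0 ->
  (forall t h, 0 <= t -> 0 <= h -> t + h <= T ->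
    e (t + h) <= (1 + L * h) * e t + C * h ^+ 2) ->
  e T <= expR (L * T) * e 0.
Proof.
move=> L0 C0 T0 e0 H.
apply: (@le_div_nat_le _ _ _ (expR (L * T) * (C * T ^+ 2))) => n.
have n0 : 0 < n.+1%:R :> R by rewrite ltr0n.
pose h := T / n.+1%:R.
have h0 : 0 <= h by rewrite divr_ge0.
have hT : h * n.+1%:R = T by rewrite /h divfK// gt_eqF.
have := @gronwall_discrete R (fun k => e (h * k%:R)) L h C n.+1 L0 h0 C0.
rewrite mulr0 hT => /(_ e0) K.
apply: le_trans (K _) _.
  move=> k kn; rewrite -[k.+1]addn1 natrD mulrDr mulr1; apply: H => //.
    by rewrite mulr_ge0.
  rewrite -hT -[X in _ + X]mulr1 -mulrDr ler_wpM2l// -(natrD _ k 1) ler_nat.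
  by rewrite addn1.
rewrite mulrDr lerD2l le_eqVlt; apply/orP; left; apply/eqP.
by rewrite -{3}hT; field; rewrite gt_eqF.
Qed.

Section integral_curves.
Variables (R : realType) (d : nat) (f : 'rV[R]_d -> 'rV[R]_d) (B : R).
Hypotheses (fB : forall x, `|f x| <= B) (fL : locally_lipschitz f).

Definition integral_curve (f : 'rV[R]_d -> 'rV[R]_d) (x : R -> 'rV[R]_d) :=
  forall t, is_derive t (1 : R) x (f (x t)).

Let B0 : 0 <= B. Proof. exact: le_trans (fB 0). Qed.

Lemma integral_curve_lipschitz x a b : integral_curve f x -> a <= b ->
  `|x b - x a| <= B * (b - a).
Proof.
move=> fx ab.
have := @is_derive_increment_le R d x (fun t => f (x t)) a b B 0 ab (fun t _ => fx t).
by rewrite scaler0 subr0; apply=> t _; rewrite subr0.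
Qed.

(** The curve moves at most [B * (b - a)], so its velocity stays within [L * B * (b - a)] of the
    initial one. *)
Lemma integral_curve_quad x a b r L : integral_curve f x -> a <= b -> 0 <= L ->
  (forall t, a <= t <= b -> `|x t| <= r) ->
  (forall u v, `|u| <= r -> `|v| <= r -> `|f u - f v| <= L * `|u - v|) ->
  `|x b - x a - (b - a) *: f (x a)| <= L * B * (b - a) ^+ 2.
Proof.
move=> fx ab L0 xr Lr.
have -> : L * B * (b - a) ^+ 2 = (L * (B * (b - a))) * (b - a) by ring.
apply: (@is_derive_increment_le R d x (fun t => f (x t))) => // t /andP[at_ tb].
apply: le_trans (Lr _ _ _ _) _; try by apply: xr; rewrite ?lexx ?at_ ?ab.
rewrite ler_wpM2l// (le_trans (integral_curve_lipschitz fx at_))// ler_wpM2l//.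
by rewrite lerD2r.
Qed.

(** Until time [T] both curves stay in the ball of radius [r0 + B * T]; comparing each with its
    Euler step there makes their distance satisfy the Gronwall recursion. *)
Lemma integral_curve_dependence r0 T : 0 <= T -> exists2 K, 0 <= K & forall x y,
  integral_curve f x -> integral_curve f y -> `|x 0| <= r0 -> `|y 0| <= r0 ->
  `|x T - y T| <= K * `|x 0 - y 0|.
Proof.
move=> T0; pose r := r0 + B * T; have [L L0 Lr] := fL r.
exists (expR (L * T)); first exact: expR_ge0.
move=> x y fx fy x0 y0.
have bnd z t : integral_curve f z -> `|z 0| <= r0 -> 0 <= t -> t <= T -> `|z t| <= r.
  move=> fz z0 t0 tT; rewrite -(subrK (z 0) (z t)) addrC.
  apply: le_trans (ler_normD _ _) _; apply: lerD => //.
  apply: le_trans (integral_curve_lipschitz fz t0) _.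
  by rewrite subr0 ler_wpM2l.
apply: (@gronwall_step R (fun t => `|x t - y t|) L (L * B + L * B)) => //.
  by rewrite addr_ge0// mulr_ge0.
move=> t h t0 h0 thT.
have tth : t <= t + h by rewrite lerDl.
have quad z : integral_curve f z -> `|z 0| <= r0 ->
    `|z (t + h) - z t - h *: f (z t)| <= L * B * h ^+ 2.
  move=> fz z0.
  have := @integral_curve_quad z t (t + h) r L fz tth L0 _ Lr.
  have -> : t + h - t = h by ring.
  apply=> u /andP[tu uth].
  by apply: bnd => //; [exact: le_trans tu|exact: le_trans thT].
have tT : t <= T by exact: le_trans thT.
have -> : x (t + h) - y (t + h) = (x (t + h) - x t - h *: f (x t)) -
    (y (t + h) - y t - h *: f (y t)) + ((x t - y t) + h *: (f (x t) - f (y t))).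
  by apply/rowP => j; rewrite !mxE; ring.
rewrite addrC; apply: le_trans (ler_normD _ _) _; apply: lerD.
  apply: le_trans (ler_normD _ _) _; rewrite mulrDl mul1r lerD2l.
  rewrite normrZ ger0_norm// [L * h]mulrC -mulrA ler_wpM2l//.
  by apply: Lr; apply: bnd.
apply: le_trans (ler_normB _ _) _; rewrite mulrDl.
by apply: lerD; apply: quad.
Qed.

Lemma integral_curve_unique_ge0 x y T : integral_curve f x -> integral_curve f y ->
  x 0 = y 0 -> 0 <= T -> x T = y T.
Proof.
move=> fx fy xy T0; have [K _ KP] := integral_curve_dependence `|x 0| T0.
have := KP x y fx fy (lexx _); rewrite xy => /(_ (lexx _)).
by rewrite subrr normr0 mulr0 normr_le0 subr_eq0 => /eqP.
Qed.

End integral_curves.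

Section flow.
Variables (R : realType) (d : nat) (f : 'rV[R]_d -> 'rV[R]_d) (B : R).
Hypotheses (fB : forall x, `|f x| <= B) (fL : locally_lipschitz f).

Lemma integral_curve_reverse x : integral_curve f x ->
  integral_curve (fun y => - f y) (fun t => x (- t)).
Proof. by move=> fx t; have H := fx (- t); exact: (is_derive_reflect H). Qed.

Let fBN x : `|- f x| <= B. Proof. by rewrite normrN. Qed.

(** Negative times reduce to positive ones by time reversal, which replaces [f] by [- f]. *)
Lemma integral_curve_unique x y T : integral_curve f x -> integral_curve f y ->
  x 0 = y 0 -> x T = y T.
Proof.
move=> fx fy xy; have [T0|T0] := leP 0 T.
  exact: (integral_curve_unique_ge0 fB fL).
have := @integral_curve_unique_ge0 R d (fun y => - f y) B fBN (locally_lipschitzN fL)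
  _ _ (- T) (integral_curve_reverse fx) (integral_curve_reverse fy).
by rewrite oppr0 opprK; apply => //; rewrite oppr_ge0 ltW.
Qed.

Variable phi : R -> 'rV[R]_d -> 'rV[R]_d.
Hypothesis flowphi : is_flow f phi.

Lemma flow0 x : phi 0 x = x. Proof. by case: (flowphi x). Qed.

Lemma flow_integral_curve x : integral_curve f (phi ^~ x).
Proof. by case: (flowphi x). Qed.

(** The group law follows from uniqueness: as functions of [s], both sides are integral curves that
    agree at [s = 0]. *)
Lemma flowD s t x : phi (s + t) x = phi s (phi t x).
Proof.
apply: (@integral_curve_unique (fun u => phi (u + t) x) (phi ^~ (phi t x))).
- by move=> u; have H := flow_integral_curve x (u + t); exact: (is_derive_translate H).
- exact: flow_integral_curve.
- by rewrite /= add0r flow0.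
Qed.

Lemma flowK t : cancel (phi t) (phi (- t)).
Proof. by move=> x; rewrite -flowD addNr flow0. Qed.

Lemma flowNK t : cancel (phi (- t)) (phi t).
Proof. by move=> x; rewrite -flowD subrr flow0. Qed.

Lemma flow_continuous t : continuous (phi t).
Proof.
apply: locally_lipschitz_continuous => r; have [t0|t0] := leP 0 t.
  have [K K0 KP] := integral_curve_dependence fB fL r t0.
  exists K => // x y xr yr.
  have := KP _ _ (flow_integral_curve x) (flow_integral_curve y).
  by rewrite /= !flow0; apply.
have t0' : 0 <= - t by rewrite oppr_ge0 ltW.
have [K K0 KP] := integral_curve_dependence fBN (locally_lipschitzN fL) r t0'.
exists K => // x y xr yr.
have := KP _ _ (integral_curve_reverse (flow_integral_curve x))
  (integral_curve_reverse (flow_integral_curve y)).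
by rewrite /= oppr0 opprK !flow0; apply.
Qed.

End flow.

(** * Relaxed trajectories *)

Lemma continuous_sum (R : realType) (T : topologicalType) (V : normedModType R)
    (I : Type) (r : seq I) (f : I -> T -> V) :
  (forall i, continuous (f i)) -> continuous (fun x => \sum_(i <- r) f i x).
Proof.
move=> fc; elim: r => [|i r IH] x.
  by under eq_fun do rewrite big_nil; exact: cvg_cst.
under eq_fun do rewrite big_cons.
by apply: cvgD; [exact: fc|exact: IH].
Qed.

Lemma continuous_dist_scale (R : realType) (T : topologicalType) (V : normedModType R)
    (m : T -> V) (c : R) (v : V) :
  continuous m -> continuous (fun x => `|v - c *: m x|).
Proof.
move=> cm x; apply: cvg_norm; apply: cvgB; first exact: cvg_cst.
by apply: cvgZl_tmp; exact: cm.
Qed.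

Section relaxed.
Variables (R : realType) (d : nat) (E : finType) (F : E -> 'rV[R]_d -> 'rV[R]_d).

Definition simplex (alpha : E -> R) := (forall i, 0 <= alpha i) /\ \sum_i alpha i = 1.

Definition mix (alpha : E -> R) (x : 'rV[R]_d) := \sum_i alpha i *: F i x.

Lemma coFE x v : coF F x v <-> exists2 alpha, simplex alpha & v = mix alpha x.
Proof.
split=> [[alpha [a0 a1 ->]]|[alpha [a0 a1] ->]]; first by exists alpha.
by exists alpha.
Qed.

Lemma simplex_index alpha : simplex alpha -> exists i : E, True.
Proof.
move=> [_ a1]; case: (pickP (fun _ : E => true)) => [i _|noE]; first by exists i.
by move: a1; rewrite big_pred0// => /eqP; rewrite eq_sym oner_eq0.
Qed.

Lemma simplex_delta (i : E) : simplex (fun j => (j == i)%:R).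
Proof.
split=> [j|]; first exact: ler0n.
by rewrite (bigD1 i)//= big1 ?addr0 ?eqxx// => j /negbTE ->.
Qed.

Lemma mix_delta (i : E) x : mix (fun j => (j == i)%:R) x = F i x.
Proof.
rewrite /mix (bigD1 i)//= eqxx scale1r big1 ?addr0// => j /negbTE ->.
by rewrite scale0r.
Qed.

Lemma simplex_avg alpha beta (t : R) : 0 <= t -> t <= 1 -> simplex alpha ->
  simplex beta -> simplex (fun i => t * alpha i + (1 - t) * beta i).
Proof.
move=> t0 t1 [a0 a1] [b0 b1]; split.
  by move=> i; rewrite addr_ge0// mulr_ge0// subr_ge0.
by rewrite big_split/= -!mulr_sumr a1 b1; ring.
Qed.

Lemma mix_avg alpha beta (t : R) x :
  mix (fun i => t * alpha i + (1 - t) * beta i) x = t *: mix alpha x + (1 - t) *: mix beta x.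
Proof.
rewrite /mix !scaler_sumr -big_split/=; apply: eq_bigr => i _.
by rewrite scalerDl !scalerA.
Qed.

Lemma mix_dist_le alpha x y c : simplex alpha ->
  (forall i, `|F i x - F i y| <= c) -> `|mix alpha x - mix alpha y| <= c.
Proof.
move=> [a0 a1] Fc; rewrite /mix -sumrB; apply: le_trans (ler_norm_sum _ _ _) _.
rewrite -[leRHS]mul1r -a1 mulr_suml; apply: ler_sum => i _.
by rewrite -scalerBr normrZ ger0_norm// ler_wpM2l.
Qed.

Lemma mix_norm_le alpha x c : simplex alpha ->
  (forall i, `|F i x| <= c) -> `|mix alpha x| <= c.
Proof.
move=> [a0 a1] Fc; apply: le_trans (ler_norm_sum _ _ _) _.
rewrite -[leRHS]mul1r -a1 mulr_suml; apply: ler_sum => i _.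
by rewrite normrZ ger0_norm// ler_wpM2l.
Qed.

(* The simplex is compact, so the distance to the convex hull is attained. *)
Lemma mix_dist_attained (c rho : R) (v y : 'rV[R]_d) :
  (forall e, 0 < e -> exists2 alpha, simplex alpha & `|v - c *: mix alpha y| <= rho + e) ->
  exists2 alpha, simplex alpha & `|v - c *: mix alpha y| <= rho.
Proof.
move=> H.
pose al (r : 'rV[R]_#|E|) i := r 0 (enum_rank i).
pose A : set 'rV[R]_#|E| := [set r | simplex (al r)].
pose g (r : 'rV[R]_#|E|) : R := `|v - c *: mix (al r) y|.
have inA alpha : simplex alpha -> exists2 r, A r & al r = alpha.
  move=> sa; exists (\row_j alpha (enum_val j)); rewrite /A/= /al.
    by under eq_fun do rewrite mxE enum_rankK.
  by apply/funext => i; rewrite mxE enum_rankK.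
have A0 : A !=set0.
  by have [alpha /inA[r Ar _] _] := H 1 ltr01; exists r.
have cal i : continuous (fun r => al r i) by move=> r; exact: coord_continuous.
have cA : compact A.
  apply: bounded_closed_compact.
    exists 1; split; first exact: num_real.
    move=> M M1 r [r0 r1]; apply: (le_trans _ (ltW M1)).
    rewrite [leLHS]/Num.Def.normr/= mx_normrE; apply: bigmax_le => // -[i j] _.
    rewrite (ord1 i) -[j]enum_valK/= ger0_norm; last exact: r0.
    rewrite -r1 (bigD1 (enum_val j))//= lerDl; apply: sumr_ge0 => k _; exact: r0.
  have -> : A = (\bigcap_i [set r | 0 <= al r i]) `&` [set r | \sum_i al r i = 1].
    by apply/seteqP; split=> r [r0 r1]; split=> // i; [move=> _|]; exact: r0.
  apply: closedI.
    apply: closed_bigI => i _.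
    by apply: (closed_comp _ (@closed_ge R 0)) => r _; exact: cal.
  apply: (closed_comp _ (@closed_eq R 1)) => r _.
  exact: (@continuous_sum _ _ R).
have cm : continuous (fun r => mix (al r) y).
  apply: (@continuous_sum _ _ 'rV[R]_d _ _ (fun i r => al r i *: F i y)) => i r.
  exact: (@continuousZr_tmp _ _ _ (fun r => al r i) (F i y) r (cal i r)).
have cg : continuous g by exact: continuous_dist_scale.
have [r Ar rmin] := EVT_min_rV A0 cA (continuous_subspaceT cg).
rewrite inE in Ar; exists (al r) => //; apply/ler_addgt0Pr => e e0.
have [alpha /inA[r' Ar' <-] le_e] := H e e0.
by apply: le_trans (rmin r' _) le_e; rewrite inE.
Qed.

(* A form of the differential inclusion that mentions neither derivatives nor
   measurability: over each [s, t] the increment is a convex combination of the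
   fields at [eta s] up to a quadratic error. *)
Definition quad_incl (C : R) (eta : R -> 'rV[R]_d) (s t : R) :=
  exists2 alpha, simplex alpha &
    `|eta t - eta s - (t - s) *: mix alpha (eta s)| <= C * (t - s) ^+ 2.

(** The difference quotient over [[t, t + h]] is near [v] by differentiability and within [C * h] of
    a convex combination. Hence [v] has distance 0 from the hull, and the distance is attained. *)
Lemma quad_incl_derive C eta t v : is_derive t (1 : R) eta v ->
  (forall s, t <= s -> quad_incl C eta t s) -> coF F (eta t) v.
Proof.
move=> dv qi; apply/coFE.
suff [alpha sa va] : exists2 alpha, simplex alpha & `|v - 1 *: mix alpha (eta t)| <= 0.
  exists alpha => //; apply/eqP; rewrite -subr_eq0 -normr_le0.
  by rewrite scale1r in va.
apply: mix_dist_attained => e e0; rewrite add0r.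
have e20 : 0 < e / 2 by rewrite divr_gt0.
have [del d0 dd] := is_derive_le dv e20.
have C1 : 0 < `|C| + 1 by rewrite ltr_wpDl.
pose h := Num.min (del / 2) (e / 2 / (`|C| + 1)).
have h0 : 0 < h by rewrite lt_min !divr_gt0.
have [|alpha sa qa] := qi (t + h); first by rewrite lerDl ltW.
exists alpha => //; rewrite scale1r.
have thE : t + h - t = h by ring.
rewrite thE in qa.
have /dd : `|t + h - t| < del.
  rewrite thE gtr0_norm// (@le_lt_trans _ _ (del / 2))//; first by rewrite ge_min lexx.
  by rewrite ltr_pdivrMr// ltr_pMr// ltr1n.
rewrite thE (gtr0_norm h0) => da.
rewrite -(ler_pM2l h0) -{1}(gtr0_norm h0) -normrZ.
have -> : h *: (v - mix alpha (eta t)) = (eta (t + h) - eta t - h *: mix alpha (eta t)) -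
   (eta (t + h) - eta t - h *: v) by apply/rowP => j; rewrite !mxE; ring.
apply: le_trans (ler_normB _ _) _.
have -> : h * e = e / 2 * h + e / 2 * h by field.
apply: lerD => //; apply: (le_trans qa); rewrite expr2 mulrA ler_wpM2r ?(ltW h0)//.
apply: (@le_trans _ _ ((`|C| + 1) * h)).
  by rewrite ler_wpM2r ?(ltW h0)// (le_trans (ler_norm _))// lerDl.
by rewrite mulrC -ler_pdivlMr// ge_min lexx orbT.
Qed.

Lemma lipschitz_derivable_rV_ae (eta : R -> 'rV[R]_d) (B : R) :
  (forall s t, `|eta s - eta t| <= B * `|s - t|) ->
  {ae @lebesgue_measure R, forall t, derivable eta t (1 : R)}.
Proof.
move=> etaB.
have H j : {ae @lebesgue_measure R, forall t, derivable (fun s => eta s 0 j) t (1 : R)}.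
  apply: (@lipschitz_derivable_ae _ _ B) => s t; apply: le_trans (etaB s t).
  by apply: le_trans (coord_normr_le _ j); rewrite !mxE.
have {}H : {ae @lebesgue_measure R, forall t, forall j,
    derivable (fun s => eta s 0 j) t (1 : R)}.
  exact: (@filter_forall _ _ _ _ (ae_filter_ringOfSetsType (@lebesgue_measure R)) H).
by apply: ae_sub H => t dt; apply/derivable_mxP => i j; rewrite (ord1 i); exact: dt.
Qed.

(** The Lipschitz bound gives absolute continuity and a derivative almost everywhere; the quadratic
    inclusion on short intervals puts this derivative in the hull. *)
Lemma quad_incl_solution_on C B (D : set R) eta :
  (forall s t, D s -> s <= t -> D t) ->
  (forall s t, `|eta s - eta t| <= B * `|s - t|) ->
  (forall s t, D s -> s <= t -> quad_incl C eta s t) ->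
  solution_on F D (eta 0) eta.
Proof.
move=> Dup etaB qi; split => //.
  move=> a b _ e e0; have B1 : 0 < `|B| + 1 by rewrite ltr_wpDl.
  exists (e / (`|B| + 1)); first by rewrite divr_gt0.
  move=> n l r lr _; rewrite ltr_pdivlMr// mulr_suml; apply: le_lt_trans.
  apply: ler_sum => k _; apply: (le_trans (etaB _ _)).
  have [_ [lrk _]] := lr k; rewrite ger0_norm ?subr_ge0// mulrC ler_wpM2l ?subr_ge0//.
  by rewrite (le_trans (ler_norm _))// lerDl.
have := lipschitz_derivable_rV_ae etaB; apply: ae_sub => t dt Dt; have dv := derivableP dt; exists ('D_1 eta t) => //.
by apply: (quad_incl_derive dv) => s ts; exact: qi ts.
Qed.

(** For empty [E] the hull is empty, so the inclusion would fail throughout [[0, 1]], which is not a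
    null set. *)
Lemma sol_pos_index x eta : sol_pos F x eta -> exists i : E, True.
Proof.
move=> [_ _ [A [mA A0 sA]]].
have [[i _]|noE] := pselect (exists i : E, True); first by exists i.
have : (@lebesgue_measure R `[0%R, 1%R]%classic <= 0)%E.
  rewrite -[leRHS]A0; apply: le_measure; rewrite ?inE//.
  move=> t; rewrite /= in_itv/= => /andP[t0 _]; apply: sA => /= H; apply: noE.
  have [|v /coFE[alpha sa _] _] := H; first by rewrite in_itv/= t0.
  exact: simplex_index sa.
by rewrite lebesgue_measure_itv/= lte_fin ltr01 sube0 lee_fin ler10.
Qed.

Variable B : R.
Hypothesis FB : forall i x, `|F i x| <= B.

(** Averaging with [K] the ball of radius [B], which is convex and contains the velocities almost
    everywhere. *)
Lemma sol_pos_lipschitz x eta s t : sol_pos F x eta -> 0 <= s -> s <= t ->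
  `|eta t - eta s| <= B * (t - s).
Proof.
move=> solx s0 st; have [_ ac der] := solx; have [i _] := sol_pos_index solx.
have sub : `[s, t]%classic `<=` `[0, +oo[%classic.
  by move=> u; rewrite /= !in_itv/= andbT => /andP[su _]; exact: le_trans su.
apply/ler_addgt0Pr => e e0.
have [|||k kB H] := @ac_average R d [set v | `|v| <= B] eta s t 0 st (ac _ _ sub) _ _ _ _ e0.
- move=> u v l l0 l1 /= uB vB; apply: le_trans (ler_normD _ _) _.
  rewrite !normrZ !ger0_norm ?subr_ge0//.
  have -> : B = l * B + (1 - l) * B by ring.
  by rewrite lerD// ler_wpM2l// subr_ge0.
- by rewrite /= normr0; exact: le_trans (FB i 0).
- move: der; apply: ae_sub => u Hu /andP[su ut]; have [|v /coFE[alpha sa ->] dv] := Hu.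
    by rewrite /= in_itv/= andbT (le_trans s0).
  by exists (mix alpha (eta u)) => //; exact: mix_norm_le.
- rewrite -(subrK ((t - s) *: k) (eta t - eta s)) addrC.
  apply: le_trans (ler_normD _ _) _; apply: lerD => //.
  by rewrite normrZ ger0_norm ?subr_ge0// mulrC ler_wpM2r ?subr_ge0.
Qed.

(** Averaging is applied to the [rho]-neighbourhood of the hull at [eta s]: it is convex, and
    contains the velocities on [[s, t]] because [eta] moves at most [B * (t - s)] there. The
    averaging error is chosen as [(t - s) ^+ 2], whence the [+ 1] in the constant. *)
Lemma sol_pos_quad_incl x eta s t r L : sol_pos F x eta -> 0 <= s -> s <= t -> 0 <= L ->
  (forall u, s <= u <= t -> `|eta u| <= r) ->
  (forall i u v, `|u| <= r -> `|v| <= r -> `|F i u - F i v| <= L * `|u - v|) ->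
  quad_incl (L * B + 1) eta s t.
Proof.
move=> solx s0 st L0 etar Lr; have [_ ac der] := solx; have [i0 _] := sol_pos_index solx.
have B0 : 0 <= B by exact: le_trans (FB i0 0).
have sub : `[s, t]%classic `<=` `[0, +oo[%classic.
  by move=> u; rewrite /= !in_itv/= andbT => /andP[su _]; exact: le_trans su.
pose al0 (i : E) : R := (i == i0)%:R.
have sal0 : simplex al0 by exact: simplex_delta.
(* A degenerate interval is treated apart, since the averaging error has to be positive. *)
have [ts|] := eqVneq t s.
  exists al0 => //; rewrite ts !subrr scale0r subr0 normr0 expr0n/= mulr0 //.
move=> ts.
have ts0 : 0 < t - s by rewrite subr_gt0 lt_neqAle eq_sym ts.
pose rho := L * (B * (t - s)).
have e0 : 0 < (t - s) ^+ 2 by rewrite exprn_gt0.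
pose K := [set v | exists2 alpha, simplex alpha & `|v - mix alpha (eta s)| <= rho].
have [|||k [alpha sa ka] H] := @ac_average R d K eta s t (mix al0 (eta s)) st (ac _ _ sub) _ _ _ _ e0.
- move=> u v l l0 l1 [alpha sa ua] [beta sb vb].
  exists (fun i => l * alpha i + (1 - l) * beta i); first exact: simplex_avg.
  rewrite mix_avg.
  have -> : l *: u + (1 - l) *: v - (l *: mix alpha (eta s) + (1 - l) *: mix beta (eta s))
    = l *: (u - mix alpha (eta s)) + (1 - l) *: (v - mix beta (eta s)).
    by rewrite !scalerBr opprD addrACA.
  apply: le_trans (ler_normD _ _) _.
  rewrite !normrZ !ger0_norm ?subr_ge0//.
  have -> : rho = l * rho + (1 - l) * rho by ring.
  by rewrite lerD// ler_wpM2l// subr_ge0.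
- by exists al0 => //; rewrite subrr normr0 /rho !mulr_ge0// ltW.
- move: der; apply: ae_sub => u Hu /andP[su ut]; have [|v /coFE[alpha sa ->] dv] := Hu.
    by rewrite /= in_itv/= andbT (le_trans s0).
  exists (mix alpha (eta u)) => //; exists alpha => //; apply: mix_dist_le => // i.
  apply: le_trans (Lr _ _ _ _ _) _; try by apply: etar; rewrite ?su ?ut ?lexx ?st.
  rewrite ler_wpM2l// (le_trans (sol_pos_lipschitz solx s0 su))// ler_wpM2l//.
  by rewrite lerD2r.
- exists alpha => //.
  have -> : eta t - eta s - (t - s) *: mix alpha (eta s) =
     (eta t - eta s - (t - s) *: k) + (t - s) *: (k - mix alpha (eta s)).
    by rewrite scalerBr addrA subrK.
  apply: le_trans (ler_normD _ _) _; rewrite addrC mulrDl mul1r.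
  apply: lerD => //; rewrite normrZ gtr0_norm//.
  have -> : L * B * (t - s) ^+ 2 = (t - s) * rho by rewrite /rho; ring.
  by rewrite ler_wpM2l// ltW.
Qed.

End relaxed.

(** * Switched trajectories and relaxation *)

Section switched.
Variables (R : realType) (d : nat) (E : finType) (F : E -> 'rV[R]_d -> 'rV[R]_d).
Variables (Phi : E -> R -> 'rV[R]_d -> 'rV[R]_d) (B : R).
Hypotheses (FB : forall i x, `|F i x| <= B) (FL : forall i, locally_lipschitz (F i)).
Hypothesis flowPhi : forall i, is_flow (F i) (Phi i).

Lemma uniform_lipschitz r : exists2 L, 0 <= L & forall i u v,
  `|u| <= r -> `|v| <= r -> `|F i u - F i v| <= L * `|u - v|.
Proof.
pose L i := sval (cid2 (FL i r)).
have [L0 LP] : (forall i, 0 <= L i) /\ (forall i u v, `|u| <= r -> `|v| <= r ->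
    `|F i u - F i v| <= L i * `|u - v|).
  by split=> i; rewrite /L; case: cid2.
exists (\sum_i L i); first exact: sumr_ge0.
move=> i u v ur vr; apply: le_trans (LP i u v ur vr) _.
by rewrite ler_wpM2r// (bigD1 i)//= lerDl sumr_ge0.
Qed.

(** Switching words are lists of pairs, free of the surplus last index in [positive_orbit], so that
    concatenation of words is composition of flows. *)
Definition steer (l : seq (E * R)) x := foldl (fun y iu => Phi iu.1 iu.2 y) x l.

Definition admissible (l : seq (E * R)) := all (fun iu => 0 <= iu.2) l.

Definition duration (l : seq (E * R)) : R := \sum_(iu <- l) iu.2.

Lemma steer_cat l1 l2 x : steer (l1 ++ l2) x = steer l2 (steer l1 x).
Proof. by rewrite /steer foldl_cat. Qed.

Lemma admissible_cat l1 l2 : admissible (l1 ++ l2) = admissible l1 && admissible l2.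
Proof. exact: all_cat. Qed.

Lemma duration_cat l1 l2 : duration (l1 ++ l2) = duration l1 + duration l2.
Proof. by rewrite /duration big_cat. Qed.

Lemma duration_ge0 l : admissible l -> 0 <= duration l.
Proof.
move=> /allP al; rewrite /duration big_seq_cond; apply: sumr_ge0 => p.
by rewrite andbT => /al.
Qed.

(* [Phi i 0 = id], so that lists without any switch may be included. *)
Lemma positive_orbitP x y : positive_orbit Phi x y <->
  (exists i : E, True) /\ exists2 l, admissible l & y = steer l x.
Proof.
split.
  move=> [n [i [u [n0 u0 ->]]]]; split; first by exists (tnth i ord0).
  exists (zip i u) => //; apply/allP => -[j v] /= jv.
  have : v \in unzip2 (zip i u) by apply/mapP; exists (j, v).
  by rewrite unzip2_zip ?size_tuple// => /tnthP[k ->]; exact: u0.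
move=> [[i0 _] [l al ->]].
wlog l0 : l al / (0 < size l)%N.
  move=> W; case: l al => [|p l] al; last exact: W.
  have := W [:: (i0, 0)]; rewrite /admissible/= lexx => /(_ erefl erefl).
  by rewrite /steer/= (flow0 (flowPhi i0)).
have si : size (rcons (unzip1 l) i0) == (size l).+1 by rewrite size_rcons size_map.
have su : size (unzip2 l) == size l by rewrite size_map.
exists (size l), (Tuple si), (Tuple su); split => //.
  move=> k; have /mapP[p pl ->] : tnth (Tuple su) k \in unzip2 l by exact: mem_tnth.
  by move/allP: al; apply.
have -> : composite_flow Phi (Tuple si) (Tuple su) x =
    foldl (fun y iu => Phi iu.1 iu.2 y) x (zip (rcons (unzip1 l) i0) (unzip2 l)) by [].
by rewrite -cats1 -[unzip2 l]cats0 zip_cat ?size_map// zip_unzip cats0.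
Qed.

Lemma steer_continuous l : continuous (steer l).
Proof.
elim/last_ind: l => [|l [i u] IH] x; first exact: cvg_id.
have -> : steer (rcons l (i, u)) = Phi i u \o steer l.
  by apply/funext => y; rewrite /= -cats1 steer_cat.
by apply: continuous_comp; [exact: IH|exact: (flow_continuous (FB i) (FL i))].
Qed.

Lemma positive_orbit_refl (i : E) x : positive_orbit Phi x x.
Proof. by apply/positive_orbitP; split; [exists i|exists [::]]. Qed.

Lemma positive_orbit_steer l x y : admissible l -> positive_orbit Phi x y ->
  positive_orbit Phi x (steer l y).
Proof.
move=> al /positive_orbitP[ei [l' al' ->]]; apply/positive_orbitP; split => //.
by exists (l' ++ l); rewrite ?admissible_cat ?al' ?al// steer_cat.
Qed.

Lemma closure_positive_orbit_steer l x y : admissible l ->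
  closure (positive_orbit Phi x) y -> closure (positive_orbit Phi x) (steer l y).
Proof.
move=> al cy U Uy; have /cy[z [xz Uz]] := @steer_continuous l y _ Uy.
by exists (steer l z); split => //; exact: positive_orbit_steer.
Qed.

(** By continuity of [steer], the closure of the orbit of [x] contains the orbit of each of its
    points. *)
Lemma closure_positive_orbit_trans x y z : closure (positive_orbit Phi x) y ->
  closure (positive_orbit Phi y) z -> closure (positive_orbit Phi x) z.
Proof.
move=> xy; rewrite [X in X z -> _]closureE; apply; split; first exact: closed_closure.
by move=> w /positive_orbitP[_ [l al ->]]; exact: closure_positive_orbit_steer.
Qed.

Lemma flow_lipschitz i x s t : s <= t -> `|Phi i t x - Phi i s x| <= B * (t - s).
Proof.
move=> st.
exact: (integral_curve_lipschitz (FB i) (flow_integral_curve (flowPhi i) x)).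
Qed.

Lemma steer_dist_le l x : admissible l -> `|steer l x - x| <= B * duration l.
Proof.
elim: l x => [|[i u] l IH] x; first by rewrite /steer/= /duration big_nil subrr normr0 mulr0.
move=> /andP[u0' al]; have u0 : 0 <= u := u0'; rewrite /duration big_cons -/(duration l) mulrDr [leRHS]addrC.
have -> : steer ((i, u) :: l) x - x =
    (steer l (Phi i u x) - Phi i u x) + (Phi i u x - x) by rewrite subrKA.
apply: le_trans (ler_normD _ _) _; apply: lerD; first exact: IH.
by have := flow_lipschitz i x u0; rewrite (flow0 (flowPhi i)) subr0.
Qed.

Section chattering.
Variables (r L h : R) (alpha : E -> R) (y : 'rV[R]_d).
Hypotheses (L0 : 0 <= L) (h0 : 0 <= h) (sa : simplex alpha).
Hypothesis Lr : forall i u v, `|u| <= r -> `|v| <= r -> `|F i u - F i v| <= L * `|u - v|.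
Hypothesis yr : `|y| + B * h <= r.

Let chatter (s : seq E) := [seq (i, alpha i * h) | i <- s].

Let chatter_admissible s : admissible (chatter s).
Proof.
by apply/allP => p /mapP[i _ ->]/=; rewrite mulr_ge0//; case: sa => + _; exact.
Qed.

Let duration_chatter s : duration (chatter s) = \sum_(i <- s) alpha i * h.
Proof. by rewrite /duration big_map. Qed.

(** Induction on the indices still to be used. By hypothesis the remaining time cannot lead from [w]
    farther than [B * h] from [y]; in that ball each field differs from its value at [y] by at most
    [L * B * h]. *)
Let chatter_err s w :
  `|w - y| + B * duration (chatter s) <= B * h ->
  `|steer (chatter s) w - w - \sum_(i <- s) (alpha i * h) *: F i y| <=
     L * B * h * duration (chatter s).
Proof.
elim: s w => [|i s IH] w; first by move=> _; rewrite big_nil subr0 /steer/= subrr normr0 /duration big_nil mulr0.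
have -> : duration (chatter (i :: s)) = alpha i * h + duration (chatter s).
  by rewrite /duration big_cons.
rewrite mulrDr addrA big_cons => H.
set a := alpha i * h in H *.
have a0 : 0 <= a by rewrite mulr_ge0//; case: sa => + _; exact.
have B0 : 0 <= B by exact: le_trans (FB i 0).
have ds0 : 0 <= B * duration (chatter s) by rewrite mulr_ge0// duration_ge0.
have dist t : 0 <= t -> t <= a -> `|Phi i t w - y| <= `|w - y| + B * t.
  move=> t0 ta; rewrite -(subrK w (Phi i t w)) -addrA addrC.
  apply: le_trans (ler_normD _ _) _; rewrite lerD2l.
  by have := flow_lipschitz i w t0; rewrite (flow0 (flowPhi i)) subr0.
have disth t : 0 <= t -> t <= a -> `|Phi i t w - y| <= B * h.
  move=> t0 ta; apply: (le_trans (dist t t0 ta)).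
  apply: le_trans H; apply: (@le_trans _ _ (`|w - y| + B * a)); last by rewrite lerDl.
  by rewrite lerD2l ler_wpM2l.
have step : `|Phi i a w - w - a *: F i y| <= L * B * h * a.
  have := @is_derive_increment_le R d (Phi i ^~ w) (fun t => F i (Phi i t w)) 0 a
    (L * B * h) (F i y) a0 (fun t _ => flow_integral_curve (flowPhi i) w t).
  rewrite /= (flow0 (flowPhi i)) subr0; apply => t /andP[t0 ta].
  have le_h := disth t t0 ta.
  apply: (le_trans (Lr i _ _)).
  - rewrite -(subrK y (Phi i t w)) addrC (le_trans (ler_normD _ _))//.
    by apply: le_trans yr; rewrite lerD2l.
  - by apply: le_trans yr; rewrite lerDl mulr_ge0.
  - by rewrite -mulrA ler_wpM2l.
have -> : steer (chatter (i :: s)) w - w - (a *: F i y + \sum_(j <- s) (alpha j * h) *: F j y)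
  = (steer (chatter s) (Phi i a w) - Phi i a w - \sum_(j <- s) (alpha j * h) *: F j y)
    + (Phi i a w - w - a *: F i y).
  have -> : steer (chatter (i :: s)) w = steer (chatter s) (Phi i a w) by [].
  by apply/rowP => j; rewrite !mxE; ring.
apply: le_trans (ler_normD _ _) _; rewrite mulrDr addrC; apply: lerD => //.
apply: IH; apply: le_trans H; rewrite lerD2r; exact: dist.
Qed.

Lemma chattering_step : exists l, [/\ admissible l, duration l = h &
  `|steer l y - y - h *: mix F alpha y| <= L * B * h ^+ 2].
Proof.
exists (chatter (enum E)).
have dE : duration (chatter (enum E)) = h.
  by rewrite duration_chatter big_enum/= -mulr_suml; case: sa => _ ->; rewrite mul1r.
split => //.
have -> : h *: mix F alpha y = \sum_(i <- enum E) (alpha i * h) *: F i y.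
  rewrite /mix scaler_sumr big_enum/=; apply: eq_bigr => i _.
  by rewrite scalerA mulrC.
apply: le_trans (chatter_err _) _; first by rewrite dE subrr normr0 add0r.
by rewrite dE expr2 mulrA.
Qed.

End chattering.

(* Relaxation (Filippov-Wazewski), endpoint version. *)
Lemma quad_incl_approx r L C x eta T : 0 <= T -> 0 <= L -> 0 <= C -> `|x| + B * T <= r ->
  (forall i u v, `|u| <= r -> `|v| <= r -> `|F i u - F i v| <= L * `|u - v|) ->
  (forall t, 0 <= t <= T -> `|eta t| <= r) ->
  (forall s t, 0 <= s -> s <= t -> t <= T -> quad_incl F C eta s t) ->
  eta 0 = x -> closure (positive_orbit Phi x) (eta T).
Proof.
move=> T0 L0 C0 xr Lr etar qi eta0.
have [al0 /simplex_index[i0 _] _] := qi 0 0 (lexx _) (lexx _) T0.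
have B0 : 0 <= B by exact: le_trans (FB i0 0).
have C'0 : 0 <= L * B + C by rewrite addr_ge0// mulr_ge0.
have key (N : nat) : exists2 l, admissible l &
    `|steer l x - eta T| <= expR (L * T) * ((L * B + C) * T ^+ 2) / N.+1%:R.
  have N0 : 0 < N.+1%:R :> R by rewrite ltr0n.
  pose h := T / N.+1%:R.
  have h0 : 0 <= h by rewrite divr_ge0.
  have hT : h * N.+1%:R = T by rewrite /h divfK// gt_eqF.
  (* The recursion for the error bound is solved with equality from 0, so that the discrete Gronwall
     inequality applies to it directly. *)
  pose e k : R := iter k (fun a => (1 + L * h) * a + (L * B + C) * h ^+ 2) 0.
  have eN : e N.+1 <= expR (L * T) * ((L * B + C) * T ^+ 2) / N.+1%:R.
    have := @gronwall_discrete R e L h (L * B + C) N.+1 L0 h0 C'0 (lexx _) (fun k _ => lexx _).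
    rewrite hT add0r => /le_trans; apply; rewrite -[leRHS]mulrA.
    suff -> : (L * B + C) * T ^+ 2 / N.+1%:R = (L * B + C) * h ^+ 2 * N.+1%:R by [].
    by rewrite -hT; field; rewrite gt_eqF.
  suff H k : (k <= N.+1)%N -> exists l, [/\ admissible l, duration l = h * k%:R &
      `|steer l x - eta (h * k%:R)| <= e k].
    have [l [al _ le_e]] := H _ (leqnn _); rewrite hT in le_e.
    by exists l => //; exact: le_trans eN.
  elim: k => [|k IH] kN.
    by exists [::]; split; rewrite // ?mulr0 /steer/= ?eta0 ?subrr ?normr0// /duration big_nil.
  have [l [al dl le_e]] := IH (ltnW kN).
  have kT : h * k%:R + h <= T.
    rewrite -hT -[X in _ + X]mulr1 -mulrDr ler_wpM2l// -(natrD _ k 1) ler_nat.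
    by rewrite addn1.
  have kh0 : 0 <= h * k%:R by rewrite mulr_ge0.
  have [alpha sa qa] : quad_incl F C eta (h * k%:R) (h * k%:R + h).
    by apply: qi => //; rewrite lerDl.
  have hE : h * k%:R + h - h * k%:R = h by ring.
  rewrite hE in qa.
  set y := steer l x in le_e; set z := eta (h * k%:R) in le_e qa.
  have yx : `|y| <= `|x| + B * (h * k%:R).
    rewrite -dl -(subrK x y) addrC (le_trans (ler_normD _ _))// lerD2l.
    exact: steer_dist_le.
  have yr : `|y| + B * h <= r.
    apply: le_trans xr; apply: le_trans (lerD yx (lexx _)) _.
    by rewrite -addrA -mulrDr lerD2l ler_wpM2l.
  (* The weights that [eta] uses on this step are imitated from the current switched position
     [y]. *)
  have [l' [al' dl' le']] := chattering_step L0 h0 sa Lr yr.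
  exists (l ++ l'); split.
  - by rewrite admissible_cat al al'.
  - by rewrite duration_cat dl dl' -[k.+1]addn1 natrD mulrDr mulr1.
  - have -> : h * k.+1%:R = h * k%:R + h by rewrite -[k.+1]addn1 natrD mulrDr mulr1.
    rewrite steer_cat -/y.
    (* Two local errors of order [h ^+ 2], and the propagated error, which grows by the factor
       [1 + L * h]. *)
    have -> : steer l' y - eta (h * k%:R + h) = ((steer l' y - y - h *: mix F alpha y) -
       (eta (h * k%:R + h) - z - h *: mix F alpha z)) +
       ((y - z) + h *: (mix F alpha y - mix F alpha z)).
      by apply/rowP => j; rewrite !mxE; ring.
    apply: le_trans (ler_normD _ _) _; rewrite /e iterS -/(e k) addrC; apply: lerD.
      apply: le_trans (ler_normD _ _) _; rewrite mulrDl mul1r; apply: lerD; first exact: le_e.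
      rewrite normrZ ger0_norm//.
      have -> : L * h * e k = h * (L * e k) by ring.
      rewrite ler_wpM2l//.
      apply: mix_dist_le => // i; apply: le_trans (Lr i _ _ _ _) _.
      - by apply: le_trans yr; rewrite lerDl mulr_ge0.
      - by apply: etar; rewrite kh0 (le_trans _ kT)// lerDl.
      - by rewrite ler_wpM2l.
    by apply: le_trans (ler_normB _ _) _; rewrite mulrDl lerD.
move=> U /nbhs_ballP[e /= e0 eU].
set c := expR (L * T) * ((L * B + C) * T ^+ 2) in key.
pose N := Num.Def.truncn (c / e).
have [l al le_c] := key N.
exists (steer l x); split; first by apply/positive_orbitP; split; [exists i0|exists l].
apply: eU; rewrite -ball_normE /ball_/= distrC; apply: (le_lt_trans le_c).
rewrite ltr_pdivrMr ?ltr0n// mulrC -ltr_pdivrMr//; exact: Num.Theory.truncnS_gt.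
Qed.

(** On [[0, T]] a solution stays in the ball of radius [|x| + B * T], where one Lipschitz constant
    gives the quadratic inclusion. *)
Lemma relaxation x eta T : 0 <= T -> sol_pos F x eta ->
  closure (positive_orbit Phi x) (eta T).
Proof.
move=> T0 solx; have [i0 _] := sol_pos_index solx.
have B0 : 0 <= B by exact: le_trans (FB i0 0).
have [eta0 _ _] := solx.
pose r := `|x| + B * T; have [L L0 Lr] := uniform_lipschitz r.
have etar t : 0 <= t <= T -> `|eta t| <= r.
  move=> /andP[t0 tT]; rewrite -(subrK (eta 0) (eta t)) addrC eta0.
  apply: le_trans (ler_normD _ _) _; rewrite lerD2l -eta0.
  apply: le_trans (sol_pos_lipschitz FB solx (lexx _) t0) _.
  by rewrite subr0 ler_wpM2l.
apply: (@quad_incl_approx r L (L * B + 1)) => //.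
  by rewrite addr_ge0// mulr_ge0.
move=> s t s0 st tT; apply: (sol_pos_quad_incl FB solx s0 st L0 _ Lr) => u /andP[su ut].
by apply: etar; rewrite (le_trans s0 su) (le_trans ut).
Qed.

End switched.

(** * Pointwise cluster points of sequences of curves *)

(** Tychonoff's theorem. Two coordinates at a time suffice, because the Lipschitz bound and
    [quad_incl] involve only two times; [n0 <= n] admits properties that hold eventually. *)
Lemma product_cluster (I : eqType) (V : topologicalType) (K : set V)
    (zeta : nat -> I -> V) : compact K -> (forall n s, K (zeta n s)) ->
  exists2 eta : I -> V, (forall s, K (eta s)) & forall s t (A B : set V) n0,
    nbhs (eta s) A -> nbhs (eta t) B ->
    exists n, [/\ (n0 <= n)%N, A (zeta n s) & B (zeta n t)].
Proof.
move=> cK Kz; pose T := prod_topology (fun _ : I => V).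
have cP : compact ([set f | forall s, K (f s)] : set T).
  exact: (@tychonoff I (fun=> V) (fun=> K) (fun=> cK)).
have zK : ((zeta : nat -> T) @ \oo) [set f | forall s, K (f s)].
  by exists 0%N => // n _ /=; exact: Kz.
have [eta [Keta clus]] := cP _ _ zK.
exists eta => // s t A B n0 sA tB.
have near_eta u (C : set V) : nbhs (eta u) C -> nbhs (eta : T) ([set f | C (f u)] : set T).
  by move=> uC; exact: (@proj_continuous I (fun=> V) u eta C uC).
pose D : set T := [set f | exists2 n, (n0 <= n)%N & f = zeta n].
have FD : ((zeta : nat -> T) @ \oo) D by exists n0 => // n /= n0n; exists n.
have nAB := @filterI _ _ (nbhs_filter (eta : T)) _ _ (near_eta s A sA) (near_eta t B tB).
have [f [Df [fA fB]]] := clus D _ FD nAB.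
by have [n n0n fE] := Df; exists n; rewrite -fE.
Qed.

(** * Curves with a Lipschitz bound and the quadratic inclusion *)

Section curves.
Variables (R : realType) (d : nat) (E : finType) (F : E -> 'rV[R]_d -> 'rV[R]_d).
Variables (Phi : E -> R -> 'rV[R]_d -> 'rV[R]_d) (B r L : R) (G : set 'rV[R]_d).
Hypotheses (FB : forall i x, `|F i x| <= B) (flowPhi : forall i, is_flow (F i) (Phi i)).
Hypothesis L0 : 0 <= L.
Hypothesis Lr : forall i u v, `|u| <= r -> `|v| <= r -> `|F i u - F i v| <= L * `|u - v|.
Hypothesis Gr : forall x, G x -> `|x| <= r.
Hypothesis Ginv : forall i t x, 0 <= t -> G x -> G (Phi i t x).

(** Flow lines satisfy this with the constant [L * B], which survives translation and concatenation
    and so serves any number of switches. *)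
Definition curve_in (a : R) (eta : R -> 'rV[R]_d) :=
  [/\ forall t, a <= t -> G (eta t),
      forall s t, a <= s -> s <= t -> `|eta t - eta s| <= B * (t - s)
    & forall s t, a <= s -> s <= t -> quad_incl F (L * B) eta s t].

Lemma flow_curve_in i z : G z -> curve_in 0 (Phi i ^~ z).
Proof.
move=> Gz; have fz := flow_integral_curve (flowPhi i) z; split.
- by move=> t t0; exact: Ginv.
- by move=> s t _ st; exact: flow_lipschitz FB flowPhi _ _ _ _ st.
- move=> s t s0 st; exists (fun j => (j == i)%:R); first exact: simplex_delta.
  rewrite mix_delta; apply: (integral_curve_quad (FB i) fz st L0 _ (Lr i)).
  by move=> u /andP[su _]; apply/Gr/Ginv => //; exact: le_trans su.
Qed.

Lemma curve_in_translate a b eta : curve_in a eta ->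
  curve_in (a - b) (fun t => eta (t + b)).
Proof.
move=> [c1 c2 c3]; split=> [t|s t|s t]; rewrite lerBlDr.
- exact: c1.
- move=> as_ st; have := c2 (s + b) (t + b) as_; rewrite lerD2r => /(_ st).
  by have -> : t + b - (s + b) = t - s by ring.
- move=> as_ st; have := c3 (s + b) (t + b) as_; rewrite lerD2r => /(_ st).
  by rewrite /quad_incl; have -> : t + b - (s + b) = t - s by ring.
Qed.

(** On an interval across [T], with lengths [a] and [b] on the two sides, the weights are averaged
    in the proportion [a : b]. Moving the second combination back to the base point [eta s] costs
    [L * B * a * b], absorbed by the cross term of [(a + b) ^+ 2]. *)
Lemma curve_in_concat eta zeta T : 0 <= T -> curve_in 0 eta -> curve_in 0 zeta ->
  zeta 0 = eta T -> curve_in 0 (fun t => if t <= T then eta t else zeta (t - T)).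
Proof.
move=> T0 [e1 e2 e3] [z1 z2 z3] zT.
have B0 : 0 <= B.
  have := e2 0 1 (lexx _) ler01; rewrite subr0 mulr1; exact: le_trans.
split=> [t t0|s t s0 st|s t s0 st].
- by case: ifPn => [_|]; [exact: e1|rewrite -ltNge => tT; apply: z1; rewrite subr_ge0 ltW].
- case: ifPn => [tT|]; first by rewrite (le_trans st tT); exact: e2.
  rewrite -ltNge => tT; case: ifPn => [sT|].
    have -> : zeta (t - T) - eta s = (zeta (t - T) - zeta 0) + (eta T - eta s).
      by rewrite zT addrA subrK.
    apply: le_trans (ler_normD _ _) _.
    have -> : B * (t - s) = B * (t - T - 0) + B * (T - s) by ring.
    by apply: lerD; [apply: z2 => //; rewrite subr_ge0 ltW|exact: e2].
  rewrite -ltNge => sT; have := z2 (s - T) (t - T).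
  have -> : t - T - (s - T) = t - s by ring.
  by apply; rewrite ?lerD2r// subr_ge0 ltW.
- rewrite /quad_incl; case: (leP t T) => [tT|tT].
    by rewrite (le_trans st tT); exact: e3.
  case: (leP s T) => [sT|sT].
    have [alpha sa qa] := e3 s T s0 sT.
    have tT0 : 0 <= t - T by rewrite subr_ge0 ltW.
    have [beta sb qb] := z3 0 (t - T) (lexx _) tT0.
    rewrite subr0 zT in qb.
    set a := T - s in qa; set b := t - T in tT0 qb *.
    have a0 : 0 <= a by rewrite subr_ge0.
    have b0 : 0 < b by rewrite subr_gt0.
    have ab0 : 0 < a + b by rewrite ltr_wpDl.
    have -> : t - s = a + b by rewrite /a /b; ring.
    exists (fun i => a / (a + b) * alpha i + (1 - a / (a + b)) * beta i).
      apply: simplex_avg => //; first by rewrite divr_ge0// ltW.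
      by rewrite ler_pdivrMr// mul1r lerDl ltW.
    rewrite mix_avg scaler_avg ?gt_eqF//.
    have -> : zeta b - eta s - (a *: mix F alpha (eta s) + b *: mix F beta (eta s)) =
       (zeta b - eta T - b *: mix F beta (eta T)) + (eta T - eta s - a *: mix F alpha (eta s))
       + b *: (mix F beta (eta T) - mix F beta (eta s)).
      by apply/rowP => j; rewrite !mxE; ring.
    apply: le_trans (ler_normD _ _) _.
    apply: (le_trans (lerD (le_trans (ler_normD _ _) (lerD qb qa)) _)).
      rewrite normrZ (gtr0_norm b0); apply: (ler_wpM2l (ltW b0)).
      apply: (mix_dist_le sb) => i; apply: le_trans (Lr i _ _) _; try by apply/Gr/e1.
      by apply: (ler_wpM2l L0); exact: e2 s0 sT.
    rewrite -/a -subr_ge0.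
    have -> : L * B * (a + b) ^+ 2 - (L * B * b ^+ 2 + L * B * a ^+ 2 + b * (L * (B * a)))
      = L * B * (a * b) by ring.
    by rewrite !mulr_ge0// ltW.
  have := z3 (s - T) (t - T); rewrite /quad_incl.
  have -> : t - T - (s - T) = t - s by ring.
  by apply; rewrite ?lerD2r// subr_ge0 ltW.
Qed.

(** The pieces are concatenated, and after the last one the flow of [i0] is followed, so that the
    curve lives on the whole half-line. *)
Lemma steer_curve_in (i0 : E) l z : admissible l -> G z -> exists eta,
  [/\ curve_in 0 eta, eta 0 = z & eta (duration l) = steer Phi l z].
Proof.
elim: l z => [|[i u] l IH] z.
  move=> _ Gz; exists (Phi i0 ^~ z); split; first exact: flow_curve_in.
    exact: flow0 (flowPhi i0) z.
  by rewrite /duration big_nil /steer /=; exact: flow0 (flowPhi i0) z.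
move=> /andP[u0' al] Gz; have u0 : 0 <= u := u0'.
have [eta [ce eta0 etal]] := IH _ al (Ginv i u0 Gz).
exists (fun t => if t <= u then Phi i t z else eta (t - u)); split.
- exact: curve_in_concat u0 (flow_curve_in i Gz) ce eta0.
- by rewrite u0 (flow0 (flowPhi i)).
- have -> : duration ((i, u) :: l) = u + duration l by rewrite /duration big_cons.
  (* If the remaining duration is 0, the final time falls into the first branch of the [if], and the
     matching condition [eta0] is used. *)
  have := duration_ge0 al; rewrite le_eqVlt => /orP[/eqP dl0|dl0].
    by rewrite -dl0 addr0 lexx -eta0 dl0 etal.
  rewrite ifF; last by apply/negbTE; rewrite -ltNge ltrDl.
  by have -> : u + duration l - u = duration l by ring.
Qed.

(** Freezing the curve before [a] through the 1-Lipschitz map [Num.max a] gives a function that is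
    Lipschitz on the whole line, as the criterion for solutions requires. *)
Lemma curve_in_lipschitz a eta s t : curve_in a eta ->
  `|eta (Num.max a s) - eta (Num.max a t)| <= B * `|s - t|.
Proof.
move=> [_ e2 _].
have B0 : 0 <= B.
  have := e2 a (a + 1) (lexx _); rewrite lerDl => /(_ ler01).
  have -> : a + 1 - a = 1 by ring.
  by rewrite mulr1; exact: le_trans.
wlog st : s t / s <= t.
  by move=> W; have [/W//|/ltW/W] := leP s t; rewrite distrC [X in _ * X]distrC.
have am : a <= Num.max a s by rewrite le_max lexx.
have mm : Num.max a s <= Num.max a t by rewrite ge_max le_max lexx/= le_max st orbT.
rewrite distrC [X in _ * X]distrC; apply: (le_trans (e2 _ _ am mm)).
rewrite ler_wpM2l// ger0_norm ?subr_ge0//.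
rewrite lerBlDr ge_max; apply/andP; split.
  rewrite -lerBlDl opprB; apply: le_trans am; lra.
rewrite -lerBlDl; have -> : t - (t - s) = s by ring.
by rewrite le_max lexx orbT.
Qed.

Lemma curve_in_sol_pos eta : curve_in 0 eta ->
  sol_pos F (eta 0) (fun t => eta (Num.max 0 t)).
Proof.
move=> ce; have [_ _ e3] := ce.
have mE t : 0 <= t -> Num.max 0 t = t by move=> t0; apply/max_idPr.
have -> : eta 0 = eta (Num.max 0 0) by rewrite mE.
apply: (@quad_incl_solution_on _ _ _ _ (L * B) B _ (fun t => eta (Num.max 0 t))).
- by move=> s t /=; rewrite !in_itv/= !andbT; exact: le_trans.
- by move=> s t; exact: curve_in_lipschitz ce.
- move=> s t; rewrite /= in_itv/= andbT => s0 st.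
  by rewrite /quad_incl !mE//; [exact: e3|exact: le_trans st].
Qed.

End curves.

(** * The accessible set *)

Section accessible.
Variables (R : realType) (d : nat) (E : finType) (F : E -> 'rV[R]_d -> 'rV[R]_d).
Variables (Phi : E -> R -> 'rV[R]_d -> 'rV[R]_d) (M : set 'rV[R]_d) (B r L : R).
Hypotheses (FB : forall i x, `|F i x| <= B) (FL : forall i, locally_lipschitz (F i)).
Hypotheses (flowPhi : forall i, is_flow (F i) (Phi i)).
Hypotheses (M_neq0 : M !=set0) (M_compact : compact M).
Hypothesis M_inv : forall i t x, 0 <= t -> M x -> M (Phi i t x).
Hypothesis L0 : 0 <= L.
Hypothesis Lr : forall i u v, `|u| <= r -> `|v| <= r -> `|F i u - F i v| <= L * `|u - v|.
Hypothesis Mr : forall x, M x -> `|x| <= r.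

Local Notation Gamma := (accessible_set Phi M).

Let M_closed : closed M.
Proof. exact: compact_closed (@norm_hausdorff _ _) M_compact. Qed.

Lemma steer_in (G : set 'rV[R]_d) : (forall i t x, 0 <= t -> G x -> G (Phi i t x)) ->
  forall l x, admissible l -> G x -> G (steer Phi l x).
Proof.
move=> Ginv; elim=> [//|[i u] l IH] x /andP[u0 al] Gx.
exact: IH al (Ginv i u x u0 Gx).
Qed.

Lemma positive_orbit_sub x : M x -> positive_orbit Phi x `<=` M.
Proof. by move=> Mx y /(positive_orbitP flowPhi)[_ [l al ->]]; exact: steer_in. Qed.

Lemma positive_orbit_flow x i t y : 0 <= t -> positive_orbit Phi x y ->
  positive_orbit Phi x (Phi i t y).
Proof.
move=> t0; apply: (positive_orbit_steer flowPhi (l := [:: (i, t)])).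
by rewrite /admissible /= t0.
Qed.

(** [M] is closed and contains the orbits of its points; over an empty [M] the intersection would be
    the whole space. *)
Lemma accessible_sub : Gamma `<=` M.
Proof.
move=> p Gp; have [x Mx] := M_neq0.
have := Gp x Mx; rewrite closureE; apply; split => //.
exact: positive_orbit_sub.
Qed.

Lemma accessible_index p : Gamma p -> exists i : E, True.
Proof.
move=> Gp; have [x Mx] := M_neq0.
have [y [/(positive_orbitP flowPhi)[ei _] _]] := Gp x Mx setT filterT.
exact: ei.
Qed.

Lemma accessible_closed : closed Gamma.
Proof. by apply: closed_bigI => x _; exact: closed_closure. Qed.

Lemma accessible_compact : compact Gamma.
Proof. exact: subclosed_compact accessible_closed M_compact accessible_sub. Qed.

Lemma accessible_closure_orbit p : Gamma p -> closure (positive_orbit Phi p) `<=` Gamma.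
Proof.
move=> Gp y yp x Mx.
exact: (closure_positive_orbit_trans FB FL flowPhi (Gp x Mx) yp).
Qed.

Lemma accessible_orbit p : Gamma p -> positive_orbit Phi p `<=` Gamma.
Proof. by move=> Gp y py; apply: (accessible_closure_orbit Gp); exact: subset_closure. Qed.

Lemma accessible_flow i t p : 0 <= t -> Gamma p -> Gamma (Phi i t p).
Proof.
move=> t0 Gp; apply: (accessible_orbit Gp); apply: positive_orbit_flow => //.
exact: (positive_orbit_refl flowPhi).
Qed.

(** A point of the intersection lies in the orbit closure of every point of [M], among them [p]; the
    other inclusion is transitivity of orbit closures. *)
Lemma accessibleE p : Gamma p -> Gamma = closure (positive_orbit Phi p).
Proof.
move=> Gp; apply/seteqP; split; last exact: accessible_closure_orbit.
by move=> q Gq; apply: Gq; exact: accessible_sub.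
Qed.

(** Prefixing a word by [(i, t)] makes its duration at least [t], and the corresponding curve from
    [x] is a relaxed solution. *)
Lemma positive_orbit_Psi_from i t x : 0 <= t -> M x ->
  positive_orbit Phi (Phi i t x) `<=` Psi_from F t x.
Proof.
move=> t0 Mx y /(positive_orbitP flowPhi)[_ [l al ->]].
have al' : admissible ((i, t) :: l) by rewrite /admissible/= t0.
have [eta [ce eta0 etal]] := steer_curve_in FB flowPhi L0 Lr Mr M_inv i al' Mx.
have dE : duration ((i, t) :: l) = t + duration l by rewrite /duration big_cons.
exists (duration ((i, t) :: l)).
  by rewrite /= in_itv/= andbT dE lerDl duration_ge0.
exists (fun s => eta (Num.max 0 s)); first by rewrite -eta0; exact: curve_in_sol_pos ce.
have -> : Num.max 0 (duration ((i, t) :: l)) = duration ((i, t) :: l).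
  by apply/max_idPr; exact: duration_ge0.
exact: etal.
Qed.

(** Already the set with [t = 0] lies in the orbit closure, by relaxation. *)
Lemma omega_limit_sub x : omega_limit F x `<=` closure (positive_orbit Phi x).
Proof.
move=> p /(_ 0) /=; rewrite in_itv/= lexx => /(_ isT).
rewrite [X in X p -> _]closureE; apply; split; first exact: closed_closure.
move=> y [s /=]; rewrite in_itv/= andbT => s0 [eta sol <-].
exact: (relaxation FB FL flowPhi).
Qed.

(** Accessibility is applied at [Phi i t x] instead of [x], so that the approximating orbit points
    are reached from [x] after time at least [t]. *)
Lemma accessible_sub_omega x : M x -> Gamma `<=` omega_limit F x.
Proof.
move=> Mx p Gp t /=; rewrite in_itv/= andbT => t0.
have [i _] := accessible_index Gp.
have := Gp _ (M_inv i t0 Mx); apply: closureS; exact: positive_orbit_Psi_from.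
Qed.

Lemma accessible_omega : Gamma = \bigcap_(x in M) omega_limit F x.
Proof.
apply/seteqP; split=> p H x Mx; first exact: accessible_sub_omega.
by apply: omega_limit_sub; exact: H.
Qed.

Lemma accessible_omega_self p : Gamma p -> Gamma = omega_limit F p.
Proof.
move=> Gp; apply/seteqP; split; first exact/accessible_sub_omega/accessible_sub.
by move=> q /omega_limit_sub; exact: accessible_closure_orbit.
Qed.

(** The orbit of [p] is a union of continuous images of the line that share the point [p], and Gamma
    is its closure. *)
Lemma accessible_connected : connected Gamma.
Proof.
have [[p Gp]|noG] := pselect (Gamma !=set0); last first.
  suff -> : Gamma = set0 by exact: connected0.
  by apply/seteqP; split=> // p Gp; exfalso; apply: noG; exists p.
rewrite (accessibleE Gp); apply: connected_closure.
have [i0 _] := accessible_index Gp.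
pose O := positive_orbit Phi p.
have Op : O p by exact: (positive_orbit_refl flowPhi).
have Or x : O x -> `|x| <= r by move=> Ox; apply/Mr/(positive_orbit_sub (accessible_sub Gp)).
have Oinv i t x : 0 <= t -> O x -> O (Phi i t x) by exact: positive_orbit_flow.
pose curve (etaT : (R -> 'rV[R]_d) * R) := curve_in F B L O 0 etaT.1 /\ etaT.1 0 = p.
have OE : O = \bigcup_(etaT in curve) ((fun t => etaT.1 (Num.max 0 t)) @` setT).
  apply/seteqP; split.
    move=> y /(positive_orbitP flowPhi)[_ [l al ->]].
    have [eta [ce eta0 etal]] := steer_curve_in FB flowPhi L0 Lr Or Oinv i0 al Op.
    exists (eta, 0); first by split.
    exists (duration l) => //=; rewrite -etal; congr eta.
    by apply/max_idPr; exact: duration_ge0.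
  by move=> y [[eta T] [[/= c1 _ _] _] [t _ <-]]; apply: c1; rewrite le_max lexx.
rewrite -/O OE; apply: bigcup_connected.
  exists p => -[eta T] [_ /= eta0]; exists 0 => //.
  by rewrite -[RHS]eta0; congr eta; exact/max_idPr.
move=> [eta T] [/= ce _]; apply: connected_continuous_connected.
  by apply/connected_intervalP.
apply: continuous_subspaceT; apply: locally_lipschitz_continuous.
by apply: (@lipschitz_locally_lipschitz _ _ _ _ B) => s t; exact: curve_in_lipschitz ce.
Qed.

Lemma accessible_positively_invariant : strongly_positively_invariant F Gamma.
Proof.
move=> t t0 y [p Gp [eta sol <-]]; apply: (accessible_closure_orbit Gp).
exact: (relaxation FB FL flowPhi).
Qed.

(** The path follows one flow from [x] for time [n], then returns close to [x], which is accessible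
    from the point reached. Its duration [T] is at least [n], and a shift by [T] places its end at
    time 0. *)
Lemma accessible_past x n e : Gamma x -> 0 < e -> exists zeta : R -> 'rV[R]_d,
  [/\ forall s, Gamma (zeta s), `|zeta 0 - x| < e
    & curve_in F B L Gamma (- n%:R) zeta].
Proof.
move=> Gx e0; have [i _] := accessible_index Gx.
have Gr z : Gamma z -> `|z| <= r by move=> /accessible_sub; exact: Mr.
have Gz : Gamma (Phi i n%:R x) by exact: accessible_flow.
have : nbhs x (ball x e) by exact: nbhsx_ballx.
move=> /(Gx _ (accessible_sub Gz))[y [/(positive_orbitP flowPhi)[_ [l al yE]] xy]].
have al' : admissible ((i, n%:R) :: l) by rewrite /admissible/= ler0n.
have [eta [ce _ etal]] := steer_curve_in FB flowPhi L0 Lr Gr accessible_flow i al' Gx.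
have dE : duration ((i, n%:R) :: l) = n%:R + duration l by rewrite /duration big_cons.
set T := duration _ in etal dE.
have dl0 := duration_ge0 al.
have T0 : 0 <= T by rewrite dE addr_ge0.
exists (fun s => eta (Num.max 0 (s + T))); split.
- by move=> s; have [c1 _ _] := ce; apply: c1; rewrite le_max lexx.
- rewrite add0r; have -> : Num.max 0 T = T by apply/max_idPr.
  by rewrite etal -[steer _ _ _]yE -normrN opprB; rewrite -ball_normE in xy.
- have [c1 c2 c3] := curve_in_translate T ce; rewrite sub0r in c1 c2 c3.
  have nT : - T <= - n%:R by rewrite lerN2 dE lerDl.
  have mE s : - n%:R <= s -> Num.max 0 (s + T) = s + T.
    by move=> ns; apply/max_idPr; rewrite -lerBlDr sub0r (le_trans nT).
  split=> [s ns|s t ns st|s t ns st].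
  + by rewrite mE//; apply: c1; exact: le_trans ns.
  + rewrite !mE//; last exact: le_trans st.
    by apply: c2 => //; exact: le_trans ns.
  + have := c3 s t (le_trans nT ns) st; rewrite /quad_incl !mE//.
    exact: le_trans st.
Qed.

(** Paths with longer and longer past, ending closer and closer to [x], have a pointwise cluster
    point in the compact set. For fixed [s <= t] the estimates hold for all large [n] and pass to
    the limit. *)
Lemma accessible_invariant : Psi_invariant F Gamma.
Proof.
move=> x Gx; have [i0 _] := accessible_index Gx.
have B0 : 0 <= B by exact: le_trans (FB i0 0).
have Gr z : Gamma z -> `|z| <= r by move=> /accessible_sub; exact: Mr.
have /choice[zeta zP] : forall n : nat, exists zeta : R -> 'rV[R]_d,
  [/\ forall s, Gamma (zeta s), `|zeta 0 - x| < n.+1%:R^-1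
    & curve_in F B L Gamma (- n%:R) zeta].
  by move=> n; apply: accessible_past => //; rewrite invr_gt0.
have Gzeta n s : Gamma (zeta n s) by have [Gz _ _] := zP n.
have [eta Geta clusU] := product_cluster accessible_compact Gzeta.
have clus s t e n0 : 0 < e -> exists n,
    [/\ (n0 <= n)%N, `|zeta n s - eta s| < e & `|zeta n t - eta t| < e].
  move=> e0; have nb u : nbhs (eta u) [set w | `|w - eta u| < e].
    by apply/nbhs_ballP; exists e => // w; rewrite -ball_normE /ball_/= distrC.
  exact: clusU s t _ _ n0 (nb s) (nb t).
have eta0 : eta 0 = x.
  apply/eqP; rewrite -subr_eq0 -normr_le0; apply/ler_addgt0Pr => e e0; rewrite add0r.
  have e20 : 0 < e / 2 by rewrite divr_gt0.
  pose n0 := Num.Def.truncn (e / 2)^-1.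
  have [n [n0n zn _]] := clus 0 0 (e / 2) n0 e20.
  have [_ zx _] := zP n.
  have -> : eta 0 - x = (zeta n 0 - x) - (zeta n 0 - eta 0) by apply/rowP => j; rewrite !mxE; ring.
  apply: le_trans (ler_normB _ _) _; rewrite [leRHS](splitr e).
  apply: lerD; last exact: ltW.
  apply: (le_trans (ltW zx)); rewrite invf_ple ?posrE//.
  apply: (le_trans (ltW (Num.Theory.truncnS_gt _))).
  by rewrite ler_nat ltnS.
have past (s : R) : exists n0 : nat, forall n, (n0 <= n)%N -> - n%:R <= s.
  exists (Num.Def.truncn (- s)).+1 => n n0n; rewrite lerNl.
  apply: (le_trans (ltW (Num.Theory.truncnS_gt _))); by rewrite ler_nat.
have etaB (s t : R) : s <= t -> `|eta t - eta s| <= B * (t - s).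
  move=> st; apply/ler_addgt0Pr => e e0.
  have e20 : 0 < e / 2 by rewrite divr_gt0.
  have [n0 n0P] := past s; have [n [n0n zs zt]] := clus s t _ n0 e20.
  have [_ _ [_ c2 _]] := zP n; have := c2 s t (n0P n n0n) st => H.
  have -> : eta t - eta s = (zeta n t - zeta n s) + ((zeta n s - eta s) - (zeta n t - eta t)).
    by apply/rowP => j; rewrite !mxE; ring.
  apply: le_trans (ler_normD _ _) _; apply: lerD => //.
  apply: le_trans (ler_normB _ _) _; rewrite [leRHS](splitr e).
  by apply: lerD; exact: ltW.
have etaQ (s t : R) : s <= t -> quad_incl F (L * B) eta s t.
  (* The weights vary with [n]; approximate inclusions with arbitrary [e] suffice because the
     distance to the hull is attained. *)
  move=> st; apply: mix_dist_attained => e e0.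
  have ts0 : 0 <= t - s by rewrite subr_ge0.
  have c0 : 0 < 2 + (t - s) * L by rewrite ltr_wpDr// mulr_ge0.
  (* In the denominator, 2 accounts for the endpoint errors and [(t - s) * L] for replacing the base
     point [zeta n s] by [eta s]. *)
  have e'0 : 0 < e / (2 + (t - s) * L) by rewrite divr_gt0.
  have [n0 n0P] := past s; have [n [n0n zs zt]] := clus s t _ n0 e'0.
  set e' := e / _ in e'0 zs zt.
  have [_ _ [_ _ c3]] := zP n.
  have [alpha sa qa] := c3 s t (n0P n n0n) st.
  exists alpha => //.
  have -> : eta t - eta s - (t - s) *: mix F alpha (eta s) =
    (zeta n t - zeta n s - (t - s) *: mix F alpha (zeta n s)) +
    (((zeta n s - eta s) - (zeta n t - eta t)) +
     (t - s) *: (mix F alpha (zeta n s) - mix F alpha (eta s))).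
    by apply/rowP => j; rewrite !mxE; ring.
  apply: le_trans (ler_normD _ _) _; apply: lerD => //.
  have -> : e = (e' + e') + (t - s) * (L * e') by rewrite /e'; field; rewrite gt_eqF.
  apply: le_trans (ler_normD _ _) _; apply: lerD.
    by apply: le_trans (ler_normB _ _) _; apply: lerD; exact: ltW.
  rewrite normrZ ger0_norm// ler_wpM2l//; apply: (mix_dist_le sa) => i.
  apply: le_trans (Lr i (Gr _ (Gzeta n s)) (Gr _ (Geta s))) _.
  by rewrite ler_wpM2l// ltW.
exists eta; last by move=> _ [s _ <-]; exact: Geta.
rewrite -eta0; apply: (@quad_incl_solution_on _ _ _ _ (L * B) B) => //.
- move=> s t; wlog st : s t / s <= t.
    by move=> W; have [/W//|/ltW/W] := leP s t; rewrite distrC [X in _ * X]distrC.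
  by rewrite distrC [X in _ * X]distrC [`|t - s|]ger0_norm ?subr_ge0//; exact: etaB.
- by move=> s t _; exact: etaQ.
Qed.

(** The preimage of Gamma under the continuous map [Phi i (- t)] is a neighbourhood of [Phi i t p],
    and each of its points is the image under [Phi i t] of a point of Gamma. *)
Lemma interior_flow i t p : 0 <= t -> Gamma° p -> Gamma° (Phi i t p).
Proof.
move=> t0 Gp; have cf := @flow_continuous _ _ _ _ (FB i) (FL i) _ (flowPhi i) (- t).
have : nbhs (Phi i t p) (Phi i (- t) @^-1` Gamma).
  by apply: cf; rewrite (flowK (FB i) (FL i) (flowPhi i)).
apply: filterS => z /= Gz; rewrite -(flowNK (FB i) (FL i) (flowPhi i) t z).
exact: accessible_flow.
Qed.

(** The orbit of an interior point is dense in Gamma and stays in the interior. *)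
Lemma accessible_interior : Gamma° = set0 \/ Gamma `<=` closure Gamma°.
Proof.
have [[y Gy]|noG] := pselect (Gamma° !=set0); [right|left].
  rewrite (accessibleE (interior_subset Gy)); apply: closureS.
  move=> z /(positive_orbitP flowPhi)[_ [l al ->]].
  rewrite -(accessibleE (interior_subset Gy)).
  by apply: (steer_in interior_flow).
by apply/seteqP; split=> // p Gp; exfalso; apply: noG; exists p.
Qed.

End accessible.

(** * Uniform constants and conclusion *)

Lemma bounded_uniform (R : realType) (T : Type) (V : normedModType R) (E : finType)
    (F : E -> T -> V) : (forall i, bounded_fun (F i)) ->
  exists B, forall i x, `|F i x| <= B.
Proof.
move=> Fb.
have /choice[b bP] : forall i, exists c : R, 0 <= c /\ forall x, `|F i x| <= c.
  move=> i; have [c [_ cP]] := Fb i; exists (`|c| + 1); split; first by rewrite addr_ge0.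
  by move=> x; apply: cP => //; rewrite (le_lt_trans (ler_norm _))// ltrDl.
exists (\sum_i b i) => i x; have [_ /(_ x) Fx] := bP i.
rewrite (bigD1 i)//= (le_trans Fx)// lerDl sumr_ge0// => j _.
by case: (bP j).
Qed.

Unset Implicit Arguments.
Set Strict Implicit.

Theorem proposition3p11 (R : realType) (d : nat) (hd : (1 <= d)%N) (E : finType)
    (F : E -> 'rV[R]_d -> 'rV[R]_d) (Phi : E -> R -> 'rV[R]_d -> 'rV[R]_d)
    (M : set 'rV[R]_d)
    (F_smooth : forall i, smooth (F i))
    (F_bounded : forall i, bounded_fun (F i))
    (Phi_flow : forall i, is_flow (F i) (Phi i))
    (M_neq0 : M !=set0) (M_compact : compact M)
    (M_inv : forall i (t : R), 0 <= t -> Phi i t @` M `<=` M) :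
  let Gamma := accessible_set Phi M in
  [/\ Gamma = \bigcap_(x in M) omega_limit F x,
      (forall p, Gamma p -> Gamma = omega_limit F p),
      [/\ compact Gamma, connected Gamma, Psi_invariant F Gamma
        & strongly_positively_invariant F Gamma]
    & Gamma° = set0 \/ Gamma `<=` closure Gamma°].
Proof.
have [B FB] := bounded_uniform F_bounded.
have FL i : locally_lipschitz (F i) by exact: class_C1_locally_lipschitz (F_smooth i 1%N).
have [r Mr] : exists r, forall x, M x -> `|x| <= r.
  have [c [_ cP]] := compact_bounded M_compact; exists (`|c| + 1) => x Mx.
  by apply: cP => //; rewrite (le_lt_trans (ler_norm _))// ltrDl.
have [L L0 Lr] := uniform_lipschitz FL r.
have Minv i t x : 0 <= t -> M x -> M (Phi i t x).
  by move=> t0 Mx; apply: (M_inv i t t0); exists x.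
move=> Gamma; split.
- exact: (accessible_omega FB FL Phi_flow M_neq0 Minv L0 Lr Mr).
- exact: (accessible_omega_self FB FL Phi_flow M_neq0 M_compact Minv L0 Lr Mr).
- split.
  + exact: (accessible_compact Phi_flow M_neq0 M_compact Minv).
  + exact: (accessible_connected FB FL Phi_flow M_neq0 M_compact Minv L0 Lr Mr).
  + exact: (accessible_invariant FB FL Phi_flow M_neq0 M_compact Minv L0 Lr Mr).
  + exact: (accessible_positively_invariant FB FL Phi_flow).
- exact: (accessible_interior FB FL Phi_flow M_neq0 M_compact Minv).
Qed.
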